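(* Let $\mathcal{F}$ be a given deep neural network class (fixed architecture, parameter bound $B_\Theta$, swish activation) on $\Omega=[0,1]^d$. Let $X_1,X_2,\dots$ be i.i.d. uniform random points on $\Omega$, and let $\mathcal{L}_n$ be built from $X_1,\dots,X_n$. (i) (Poisson) Let $f$ be bounded in $\Omega$ and take $\mathcal{L}=\mathcal{L}_P$, $\mathcal{L}_n=\mathcal{L}_{n,P}$. Then there exists a positive constant $\lambda_1$ independent of $n$ such that for all integers $n\ge 2$, $$\mathbb{E}\big[|\mathcal{L}(u_n)-\mathcal{L}_n(u_n)|\big]\le \lambda_1 n^{-1/2}(\log n)^{1/2}\quad\text{and}\quad \mathbb{E}\big[|\mathcal{L}(u_{\mathcal F})-\mathcal{L}_n(u_{\mathcal F})|\big]\le \lambda_1 n^{-1/2}(\log n)^{1/2}.$$ (ii) (Static Schrödinger) Let $g$ be bounded in $\Omega$ and take $\mathcal{L}=\mathcal{L}_S$, $\mathcal{L}_n=\mathcal{L}_{n,S}$. Then there exists a positive constant $\lambda_2$ independent of $n$ such that for all integers $n\ge 2$, $$\mathbb{E}\big[|\mathcal{L}(u_n)-\mathcal{L}_n(u_n)|\big]\le \lambda_2 n^{-1/2}(\log n)^{1/2}\quad\text{and}\quad \mathbb{E}\big[|\mathcal{L}(u_{\mathcal F})-\mathcal{L}_n(u_{\mathcal F})|\big]\le \lambda_2 n^{-1/2}(\log n)^{1/2}.$$ Here $u_{\mathcal F}\in\arg\min_{v\in\mathcal{F}}\mathcal{L}(v)$ and $u_n\in\arg\min_{v\in\mathcal{F}}\mathcal{L}_n(v)$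 (a measurable choice depending on the sample points), and expectations are over the sample points.
   Context: Network: $\Omega=[0,1]^d$, $d\ge1$; activation $\sigma(x)=x/(1+e^{-x})$, applied componentwise. Fix a depth $L\ge1$, layer sizes $d_0=d$, $d_1,\dots,d_{L-1}\ge1$, $d_L=1$, and $B_\Theta>0$. Parameters $\theta=\{(A_i,B_i)\}_{i=1}^L$, $A_i\in\mathbb{R}^{d_i\times d_{i-1}}$, $B_i\in\mathbb{R}^{d_i}$, are identified with vectors in $\mathbb{R}^D$, $D=\sum_{i=1}^L d_i+\sum_{i=1}^L d_i d_{i-1}$, and $\Theta=\{\theta\in\mathbb{R}^D:\|\theta\|_{\ell_\infty}\le B_\Theta\}$. With $T_i(s)=A_is+B_i$, $v(\cdot;\theta)=T_L\circ\sigma\circ T_{L-1}\circ\sigma\circ\cdots\circ\sigma\circ T_1$, and $\mathcal{F}=\{v(\cdot;\theta):\theta\in\Theta\}$. Data: $f\in L^2(\Omega)$ with $\int_\Omega f\,dx=0$; $V\in L^\infty(\Omega)$ with $0<V_{min}\le V(x)\le V_{max}<\infty$ on $\Omega$ for constants $V_{min},V_{max}$; $f,g,V$ are (measurable) functions defined pointwise on $\Omega$. Loss functionals: $$\mathcal{L}_P(u)=\int_\Omega\Big(\tfrac12\|\nabla u(x)\|_{\ell_2}^2-f(x)u(x)\Big)dx+\tfrac12\Big(\int_\Omega u(x)\,dx\Big)^2,$$ $$\mathcal{L}_S(u)=\int_\Omega\Big(\tfrac12\|\nabla u(x)\|_{\ell_2}^2+\tfrac12V(x)|u(x)|^2-g(x)u(x)\Big)dx.$$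 Empirical loss functionals for sample points $X_1,\dots,X_n$: $$\mathcal{L}_{n,P}(u)=\frac1n\sum_{j=1}^n\Big(\tfrac12\|\nabla u(X_j)\|_{\ell_2}^2-f(X_j)u(X_j)\Big)+\tfrac12\Big(\frac1n\sum_{j=1}^nu(X_j)\Big)^2,$$ $$\mathcal{L}_{n,S}(u)=\frac1n\sum_{j=1}^n\Big(\tfrac12\|\nabla u(X_j)\|_{\ell_2}^2-g(X_j)u(X_j)+\tfrac12V(X_j)|u(X_j)|^2\Big).$$ *)

(* Defs.v *)
From HB Require Import structures.
From mathcomp Require Import all_boot all_order all_algebra.
From mathcomp Require Import all_classical all_reals all_analysis.

Set Implicit Arguments.
Unset Strict Implicit.
Unset Printing Implicit Defensive.

Import Order.TTheory GRing.Theory Num.Theory.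
Import numFieldNormedType.Exports.

Local Open Scope classical_set_scope.
Local Open Scope ring_scope.

(* Points of R^d are column vectors; 'cV[R]_d carries the product of the d
   Borel sigma-algebras of R, i.e., the one generated by the coordinates. *)
Definition vec_display : measure_display.
Proof. exact: default_measure_display. Qed.

Section vec_measurable.
Variables (R : realType) (d : nat).

Definition vec_coord (i : 'I_d) (x : 'cV[R]_d) : R := x i ord0.

Let vec_set0 : g_sigma_preimage vec_coord set0.
Proof. exact: sigma_algebra0. Qed.

Let vec_setC A : g_sigma_preimage vec_coord A ->
  g_sigma_preimage vec_coord (~` A).
Proof. exact: sigma_algebraC. Qed.

Let vec_bigcup (F : (set 'cV[R]_d)^nat) :
  (forall i, g_sigma_preimage vec_coord (F i)) ->
  g_sigma_preimage vec_coord (\bigcup_i (F i)).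
Proof. exact: sigma_algebra_bigcup. Qed.

HB.instance Definition _ := @isMeasurable.Build vec_display
  'cV[R]_d (g_sigma_preimage vec_coord) vec_set0 vec_setC vec_bigcup.

End vec_measurable.

Section vec_measurable_fun.
Variable R : realType.

Lemma measurable_vec_coord d (i : 'I_d) :
  measurable_fun [set: 'cV[R]_d] (vec_coord i).
Proof.
move=> _ Y mY; rewrite setTI; apply: sub_sigma_algebra => /=.
rewrite -bigcup_seq/=; exists i => /=; first by rewrite mem_index_enum.
by exists Y => //; rewrite setTI.
Qed.

Lemma measurable_fun_vecP disp (T : measurableType disp) d (f : T -> 'cV[R]_d) :
  measurable_fun [set: T] f <->
  forall i, measurable_fun [set: T] (fun t => f t i ord0).
Proof.
split=> [mf i|mf].
  exact: (measurableT_comp (measurable_vec_coord i) mf).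
pose G := \big[setU/set0]_(i < d)
  preimage_set_system setT (@vec_coord R d i) measurable.
apply: (@measurability _ _ _ _ setT f G) => //.
move=> _ [A + <-]; rewrite setTI /G -bigcup_seq => -[i _ [B mB <-]].
rewrite setTI -comp_preimage -[X in measurable X]setTI.
exact: (mf i measurableT B mB).
Qed.

Definition vcons d (p : R * 'cV[R]_d) : 'cV[R]_d.+1 :=
  \col_i (if unlift ord0 i is Some j then p.2 j ord0 else p.1).

Definition vuncons d (x : 'cV[R]_d.+1) : R * 'cV[R]_d :=
  (x ord0 ord0, \col_i x (lift ord0 i) ord0).

Lemma vconsK d : cancel (@vcons d) (@vuncons d).
Proof.
move=> [t x]; rewrite /vuncons /vcons mxE unlift_none; congr pair.
by apply/colP => i; rewrite !mxE liftK.
Qed.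

Lemma vunconsK d : cancel (@vuncons d) (@vcons d).
Proof.
by move=> x; apply/colP => i; rewrite mxE; case: unliftP => [j|] -> //=; rewrite mxE.
Qed.

Lemma measurable_vcons d : measurable_fun [set: R * 'cV[R]_d] (@vcons d).
Proof.
apply/measurable_fun_vecP => i.
rewrite /vcons; case: (unliftP ord0 i) => [j|] ->.
  under eq_fun do rewrite mxE liftK.
  exact: (measurableT_comp (measurable_vec_coord j) measurable_snd).
under eq_fun do rewrite mxE unlift_none.
exact: measurable_fst.
Qed.

Lemma measurable_vuncons d : measurable_fun [set: 'cV[R]_d.+1] (@vuncons d).
Proof.
apply/measurable_fun_pairP; split.
  exact: measurable_vec_coord.
apply/measurable_fun_vecP => i.
rewrite (_ : (fun _ => _) = vec_coord (lift ord0 i)).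
  exact: measurable_vec_coord.
by apply/funext => x; rewrite /= mxE.
Qed.

End vec_measurable_fun.


Section lebesgue_step.
Context (R : realType) (d : nat).
Variable m : {sigma_finite_measure set 'cV[R]_d -> \bar R}.

Definition lebesgue_vcons : set 'cV[R]_d.+1 -> \bar R :=
  pushforward (lebesgue_measure \x m)%E (@vcons R d).

Let mvcons := @measurable_vcons R d.

Let lebesgue_vcons0 : lebesgue_vcons set0 = 0%E.
Proof. exact: measure0. Qed.

Let lebesgue_vcons_ge0 A : (0 <= lebesgue_vcons A)%E.
Proof. exact: measure_ge0. Qed.

Let lebesgue_vcons_sigma_additive : semi_sigma_additive lebesgue_vcons.
Proof. exact: measure_semi_sigma_additive. Qed.

HB.instance Definition _ := isMeasure.Build _ _ _ lebesgue_vcons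
  lebesgue_vcons0 lebesgue_vcons_ge0 lebesgue_vcons_sigma_additive.

Let lebesgue_vcons_sigma_finite : sigma_finite setT lebesgue_vcons.
Proof.
have /sigma_finiteP[F [TF ndF mF]] := sigma_finiteT (@lebesgue_measure R).
have /sigma_finiteP[G [TG ndG mG]] := sigma_finiteT m.
exists (fun k => @vuncons R d @^-1` (F k `*` G k)).
  apply/esym; rewrite -subTset => x _.
  have [k _ Fk] : (\bigcup_k F k) (vuncons x).1 by rewrite -TF.
  have [l _ Gl] : (\bigcup_k G k) (vuncons x).2 by rewrite -TG.
  exists (maxn k l) => //; split.
    by move: Fk; exact/subsetPset/ndF/leq_maxl.
  by move: Gl; exact/subsetPset/ndG/leq_maxr.
move=> k; have [mFk Fk] := mF k; have [mGk Gk] := mG k; split.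
  rewrite -[X in measurable X]setTI; apply: measurable_vuncons => //.
  exact: measurableX.
rewrite /lebesgue_vcons /pushforward -comp_preimage.
rewrite (_ : _ \o _ = id); last by apply/funext => x; exact: vconsK.
rewrite preimage_id product_measure1E//.
by rewrite lte_mul_pinfty// ge0_fin_numE.
Qed.

HB.instance Definition _ := Measure_isSigmaFinite.Build _ _ _ lebesgue_vcons
  lebesgue_vcons_sigma_finite.

End lebesgue_step.

(* Lebesgue measure on the Borel sets of R^d, built as the iterated product
   measure; see lebesgue_rd_box. *)
Fixpoint lebesgue_rd (R : realType) (d : nat) :
    {sigma_finite_measure set 'cV[R]_d -> \bar R} :=
  match d with
  | 0 => \d_ (0 : 'cV[R]_0)
  | d'.+1 => lebesgue_vcons (lebesgue_rd R d')
  end.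

Lemma lebesgue_rd_box (R : realType) (d : nat) (a b : 'I_d -> R) :
  (forall i, a i <= b i) ->
  lebesgue_rd R d [set x | forall i, a i <= x i ord0 <= b i] =
  (\prod_(i < d) (b i - a i))%:E.
Proof.
elim: d a b => [|d IHd] a b leab /=.
  by rewrite big_ord0 diracE mem_set//= => -[].
set B := [set x : 'cV[R]_d |
  forall i, a (lift ord0 i) <= x i ord0 <= b (lift ord0 i)].
have mB : measurable B.
  rewrite (_ : B = \bigcap_(i in [set: 'I_d])
      vec_coord i @^-1` `[a (lift ord0 i), b (lift ord0 i)]%classic).
    apply: fin_bigcap_measurable => // i _.
    by rewrite -[X in measurable X]setTI; exact: measurable_vec_coord.
  apply/seteqP; split => x /= Bx i; first by move=> _; rewrite /= in_itv/=.
  by have := Bx i I; rewrite /= in_itv.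
rewrite /lebesgue_vcons /pushforward.
rewrite (_ : _ @^-1` _ = (`[a ord0, b ord0]%classic : set R) `*` B).
  rewrite product_measure1E// IHd//.
  rewrite big_ord_recl EFinM; congr (_ * _)%E.
  apply: (eq_trans (lebesgue_measure_itv _)); rewrite /= lte_fin.
  have := leab ord0; rewrite le_eqVlt => /predU1P[->|->//].
  by rewrite ltxx subrr.
apply/seteqP; split => -[t x] /=.
  move=> H; split.
    by have := H ord0; rewrite mxE unlift_none /= in_itv.
  by move=> i; have := H (lift ord0 i); rewrite mxE liftK.
rewrite in_itv/= => -[H0 H1] i; rewrite mxE.
by case: unliftP => [j|] ->.
Qed.

Section deep_ritz.
Variable R : realType.

Definition swish (x : R) : R := x / (1 + expR (- x)).

(* theta = ((A_1, B_1), ..., (A_L, B_L)) for a network of depth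
   L = (size hidden).+1 with layer sizes d_0 = d, (d_1, ..., d_(L-1)) = hidden
   and d_L = 1. *)
Fixpoint nn_param (d : nat) (hidden : seq nat) : Type :=
  match hidden with
  | [::] => 'M[R]_(1, d) * 'cV[R]_1
  | k :: hidden' => ('M[R]_(k, d) * 'cV[R]_k) * nn_param k hidden'
  end.

Fixpoint nn_eval (d : nat) (hidden : seq nat) :
    nn_param d hidden -> 'cV[R]_d -> R :=
  match hidden return nn_param d hidden -> 'cV[R]_d -> R with
  | [::] => fun theta x => (theta.1 *m x + theta.2) ord0 ord0
  | k :: hidden' => fun theta x =>
      nn_eval theta.2 (map_mx swish (theta.1.1 *m x + theta.1.2))
  end.

(* ||theta||_infty <= B, where theta is the vector of all the weights and
   biases. *)
Definition layer_bounded (B : R) (m n : nat)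
    (l : 'M[R]_(m, n) * 'cV[R]_m) : Prop :=
  (forall i j, `|l.1 i j| <= B) /\ (forall i, `|l.2 i ord0| <= B).

Fixpoint nn_bounded (B : R) (d : nat) (hidden : seq nat) :
    nn_param d hidden -> Prop :=
  match hidden return nn_param d hidden -> Prop with
  | [::] => fun theta => layer_bounded B theta
  | k :: hidden' => fun theta =>
      layer_bounded B theta.1 /\ nn_bounded B theta.2
  end.

Definition nn_class (d : nat) (hidden : seq nat) (B : R) : set ('cV[R]_d -> R) :=
  [set nn_eval theta | theta in [set theta : nn_param d hidden |
                                   nn_bounded B theta]].

Definition cube (d : nat) : set 'cV[R]_d :=
  [set x | forall i, 0 <= x i ord0 <= 1].

Definition bounded_on (T : Type) (A : set T) (f : T -> R) : Prop :=
  exists M : R, forall x, A x -> `|f x| <= M.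

Definition grad (d : nat) (u : 'cV[R]_d -> R) (x : 'cV[R]_d) : 'cV[R]_d :=
  \col_i 'D_(delta_mx i ord0) u x.

Definition l2norm (d : nat) (x : 'cV[R]_d) : R :=
  Num.sqrt (\sum_(i < d) x i ord0 ^+ 2).

Section losses.
Variables (d : nat) (f g V : 'cV[R]_d -> R).
Local Notation mu := (lebesgue_rd R d).
Local Notation Omega := (@cube d).

Definition loss_poisson (u : 'cV[R]_d -> R) : R :=
  \int[mu]_(x in Omega) (2^-1 * l2norm (grad u x) ^+ 2 - f x * u x)
  + 2^-1 * (\int[mu]_(x in Omega) u x) ^+ 2.

Definition loss_schrodinger (u : 'cV[R]_d -> R) : R :=
  \int[mu]_(x in Omega)
    (2^-1 * l2norm (grad u x) ^+ 2 + 2^-1 * V x * `|u x| ^+ 2 - g x * u x).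

Definition emp_loss_poisson (n : nat) (s : n.-tuple 'cV[R]_d)
    (u : 'cV[R]_d -> R) : R :=
  n%:R^-1 * (\sum_(j < n) (2^-1 * l2norm (grad u (tnth s j)) ^+ 2
                           - f (tnth s j) * u (tnth s j)))
  + 2^-1 * (n%:R^-1 * \sum_(j < n) u (tnth s j)) ^+ 2.

Definition emp_loss_schrodinger (n : nat) (s : n.-tuple 'cV[R]_d)
    (u : 'cV[R]_d -> R) : R :=
  n%:R^-1 * (\sum_(j < n) (2^-1 * l2norm (grad u (tnth s j)) ^+ 2
                           - g (tnth s j) * u (tnth s j)
                           + 2^-1 * V (tnth s j) * `|u (tnth s j)| ^+ 2)).

End losses.

Definition argmin (T : Type) (F : set T) (loss : T -> R) : set T :=
  [set u | F u /\ forall v, F v -> loss u <= loss v].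

Definition samples (d n : nat) : set (n.-tuple 'cV[R]_d) :=
  [set s | forall j, cube (tnth s j)].

(* A measurable selection u of s |-> argmin_F (loss s) over the samples s in
   Omega^n. The functions of interest are continuous on the compact Omega, and
   the Borel sigma-algebra of C(Omega) is generated by the evaluations at the
   points of Omega: this is the measurability that is required of u. *)
Definition measurable_argmin (d n : nat) (F : set ('cV[R]_d -> R))
    (loss : n.-tuple 'cV[R]_d -> ('cV[R]_d -> R) -> R)
    (u : n.-tuple 'cV[R]_d -> 'cV[R]_d -> R) : Prop :=
  (forall s, samples s -> argmin F (loss s) (u s)) /\
  (forall x, cube x -> measurable_fun (@samples d n) (fun s => u s x)).

Section sampling.
Context (disp : measure_display) (W : measurableType disp).
Variables (P : probability W R) (d : nat) (X : nat -> W -> 'cV[R]_d).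

Definition mutually_independent : Prop :=
  forall (J : seq nat) (A : nat -> set 'cV[R]_d), uniq J ->
    (forall j, measurable (A j)) ->
    P (\bigcap_(j in [set` J]) X j @^-1` A j) =
    (\prod_(j <- J) P (X j @^-1` A j))%E.

Definition iid_uniform : Prop :=
  [/\ forall j, measurable_fun [set: W] (X j),
      forall j w, cube (X j w),
      forall j A, measurable A ->
        P (X j @^-1` A) = lebesgue_rd R d (A `&` @cube d) &
      mutually_independent].

Definition sample (n : nat) (w : W) : n.-tuple 'cV[R]_d := [tuple X j w | j < n].

End sampling.

End deep_ritz.

Arguments cube {R d}.
Arguments nn_class {R d}.

(* Main.v *)
Require Import Defs.
From HB Require Import structures.
From mathcomp Require Import all_boot all_order all_algebra.
From mathcomp Require Import all_classical all_reals all_analysis.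
From mathcomp Require Import ring lra measurable_realfun.

Set Implicit Arguments.
Unset Strict Implicit.
Unset Printing Implicit Defensive.

Import Order.TTheory GRing.Theory Num.Theory.
Import numFieldNormedType.Exports.

Local Open Scope classical_set_scope.
Local Open Scope ring_scope.

(* Both losses are averages of an integrand F(theta, x) built from the network
   and its gradient (plus, for Poisson, the square of an average). On bounded
   parameters and the cube, F is bounded and Lipschitz in theta uniformly in x,
   because it is obtained from the parameters by sums, products and compositions
   with the logistic sigmoid. A grid of mesh 1/n in parameter space has only
   n^D points; exponential moments of the centred sample sums at those points,
   together with a union bound, control the deviation uniformly in theta at the
   rate sqrt(ln n / n). The minimizers lie in the class, so this uniform bound
   applies to them. *)

(** * The network and its gradient *)

(** The logarithm in the rate is the price of the grid: at mesh [1/n] the discretization error is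
    already below the rate, while the union bound over [n ^ D] points costs [D ln n], which is
    [n * rate ^ 2] up to a constant. Neither chaining nor symmetrization is therefore called for.
    The exponential parameter is of order [sqrt (ln n / n)]: small enough for the quadratic bound on
    the exponential, and large enough that a deviation of [ln n / s] in a sum of [n] terms becomes
    the rate after division by [n]. The supremum over all parameters is never formed. It is replaced
    by a majorant that depends on the finitely many net points only, so its measurability is
    elementary. Independence is given on events alone, whereas the exponential moments require a
    product formula for expectations; this is rebuilt from indicators, simple functions and monotone
    convergence. *)

Section network.
Variable R : realType.

Definition sigmoid (x : R) : R := (1 + expR (- x))^-1.

(** The derivative of swish as a polynomial in [x] and [sigmoid x]: gradients are then built from
    the same operations as the network itself. *)
Definition dswish (x : R) : R :=
  sigmoid x + x * (sigmoid x * (1 - sigmoid x)).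

Lemma sigmoid_den_gt0 (x : R) : 0 < 1 + expR (- x).
Proof. by rewrite addr_gt0// expR_gt0. Qed.

Lemma norm_sigmoid_le1 (x : R) : `|sigmoid x| <= 1.
Proof.
rewrite ger0_norm ?invr_ge0 ?(ltW (sigmoid_den_gt0 x))//.
by rewrite invf_le1 ?sigmoid_den_gt0// lerDl expR_ge0.
Qed.

(** For [y <= x] put the difference over the common denominator. The tangent inequality
    [1 + t <= exp t] at [t = y - x] bounds the numerator by [exp (- y) * (x - y)], and the
    denominator is at least [exp (- y)]. *)
Lemma sigmoid_lipschitz (x y : R) : `|sigmoid x - sigmoid y| <= `|x - y|.
Proof.
wlog yx : x y / y <= x.
  by move=> H; case: (leP y x) => [/H//|/ltW/H]; rewrite distrC (distrC y).
have -> : sigmoid x - sigmoid y =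
    (expR (- y) - expR (- x)) / ((1 + expR (- x)) * (1 + expR (- y))).
  rewrite /sigmoid; field.
  by rewrite !gt_eqF ?sigmoid_den_gt0.
have e_ge0 : 0 <= expR (- y) - expR (- x) by rewrite subr_ge0 ler_expR lerN2.
rewrite !ger0_norm ?subr_ge0//; last first.
  by rewrite divr_ge0// mulr_ge0 ?(ltW (sigmoid_den_gt0 _)).
rewrite ler_pdivrMr ?mulr_gt0 ?sigmoid_den_gt0//.
have -> : expR (- x) = expR (- y) * expR (y - x).
  by rewrite -expRD addrA addNr add0r.
have := expR_ge1Dx (y - x); have := expR_gt0 (- y); have := expR_gt0 (y - x).
set a := expR (- y); set b := expR _ => b0 a0 ba.
have xy0 : 0 <= x - y by rewrite subr_ge0.
have h1 : a * (1 - b) <= a * (x - y) by rewrite ler_pM2l//; lra.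
apply: (@le_trans _ _ (a * (x - y))); first by lra.
rewrite mulrC ler_wpM2l//.
by have := mulr_gt0 a0 b0; nra.
Qed.

Lemma is_derive_swish (x : R) : is_derive x 1 (@swish R) (dswish x).
Proof.
have d1 : is_derive x 1 (cst 1 + (@expR R \o -%R)) (- expR (- x)).
  have := is_derive1_comp (is_derive_expR (- x)) (is_deriveNid x (1 : R)).
  by rewrite mulrN1 => dE; apply: is_derive_eq; rewrite add0r.
have D0 : (cst 1 + (@expR R \o -%R)) x != 0 by rewrite gt_eqF ?sigmoid_den_gt0.
have d2 : is_derive x 1 (fun y => ((cst 1 + (@expR R \o -%R)) y)^-1)
    (sigmoid x * (1 - sigmoid x)).
  split; first by apply: derivableV.
  rewrite deriveV// derive_val /= /GRing.scale/= !fctE /sigmoid; field.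
  by rewrite gt_eqF ?sigmoid_den_gt0.
rewrite (_ : @swish R = id * (fun y => ((cst 1 + (@expR R \o -%R)) y)^-1))//.
by apply: is_derive_eq; rewrite /GRing.scale/= mulr1 addrC.
Qed.

(* Forward-mode directional derivative of [nn_eval theta] at [x] along [v]. *)
Fixpoint nn_dir (d : nat) (hidden : seq nat) :
    nn_param R d hidden -> 'cV[R]_d -> 'cV[R]_d -> R :=
  match hidden return nn_param R d hidden -> 'cV[R]_d -> 'cV[R]_d -> R with
  | [::] => fun theta _ v => (theta.1 *m v) ord0 ord0
  | k :: hidden' => fun theta x v =>
      let y := theta.1.1 *m x + theta.1.2 in
      nn_dir theta.2 (map_mx (@swish R) y)
        (\col_i (dswish (y i ord0) * (theta.1.1 *m v) i ord0))
  end.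

Lemma is_derive_affine (m n : nat) (A : 'M[R]_(m, n)) (b : 'cV[R]_m)
    (y : R -> 'cV[R]_n) (v : 'cV[R]_n) (t : R) :
  (forall j, is_derive t 1 (fun s => y s j ord0) (v j ord0)) ->
  forall i, is_derive t 1 (fun s => (A *m y s + b) i ord0) ((A *m v) i ord0).
Proof.
move=> dy i.
rewrite (_ : (fun s => _) = \sum_(j < n) (A i j \*: (fun s => y s j ord0))
    + cst (b i ord0)); last first.
  apply/funext => s; rewrite !mxE /= fctE fct_sumE; congr (_ + _).
apply: is_derive_eq; rewrite addr0 mxE; exact: eq_bigr.
Qed.

(** An arbitrary differentiable curve [y] replaces the straight line, because a line is no longer a
    line once it has passed through the first activation. *)
Lemma is_derive_nn_eval (d : nat) (hidden : seq nat)
    (theta : nn_param R d hidden) (y : R -> 'cV[R]_d) (v : 'cV[R]_d) (t : R) :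
  (forall j, is_derive t 1 (fun s => y s j ord0) (v j ord0)) ->
  is_derive t 1 (fun s => nn_eval theta (y s)) (nn_dir theta (y t) v).
Proof.
elim: hidden d theta y v => [|k hidden IH] d theta y v dy /=.
  exact: is_derive_affine.
apply: (IH _ theta.2
  (fun s => map_mx (@swish R) (theta.1.1 *m y s + theta.1.2))) => i.
rewrite [X in is_derive _ _ _ X]mxE.
under eq_fun do rewrite mxE.
have dA := is_derive_affine theta.1.1 theta.1.2 dy i.
have := is_derive1_comp (f := @swish R) (is_derive_swish _) dA.
rewrite mulrC; exact.
Qed.

Lemma grad_nn_eval (d : nat) (hidden : seq nat) (theta : nn_param R d hidden)
    (x : 'cV[R]_d) (i : 'I_d) :
  grad (nn_eval theta) x i ord0 = nn_dir theta x (delta_mx i ord0).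
Proof.
rewrite mxE.
have : is_derive (0:R) 1 (fun s => nn_eval theta (x + s *: delta_mx i ord0))
  (nn_dir theta x (delta_mx i ord0)).
  have /= := @is_derive_nn_eval _ _ theta (fun s => x + s *: delta_mx i ord0)
    (delta_mx i ord0) 0.
  rewrite scale0r addr0; apply => j.
  set c := (delta_mx i ord0 : 'cV[R]_d) j ord0.
  rewrite (_ : (fun s => _) = cst (x j ord0) + (c \*: (@id R))); last first.
    by apply/funext => s; rewrite !fctE !mxE mulrC /c mxE.
  have /(is_deriveZ c) dc := is_derive_id (0 : R) (1 : R).
  have := is_deriveD (is_derive_cst (x j ord0 : R) (0 : R) (1 : R)) dc.
  by rewrite add0r /GRing.scale/= mulr1.
(* The derivative at 0 along the line and the directional derivative at [x] are limits of one and
   the same difference quotient. *)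
move=> [_ <-]; rewrite /derive.
set p := (fun _ : R => _); set q := (fun _ : R => _).
suff -> : p = q by [].
rewrite {}/p {}/q funeqE => h /=; rewrite addr0 scale0r addr0.
by rewrite [h%:A]mulr1 [x + _]addrC.
Qed.

(** * Function classes closed under the operations of the network *)

Fixpoint nn_entries (T : Type) (C : (T -> R) -> Prop) (d : nat)
    (hidden : seq nat) : (T -> nn_param R d hidden) -> Prop :=
  match hidden return (T -> nn_param R d hidden) -> Prop with
  | [::] => fun theta =>
      (forall i j, C (fun t => (theta t).1 i j)) /\
      (forall i, C (fun t => (theta t).2 i ord0))
  | k :: hidden' => fun theta =>
      ((forall i j, C (fun t => (theta t).1.1 i j)) /\
       (forall i, C (fun t => (theta t).1.2 i ord0))) /\
      nn_entries C (fun t => (theta t).2)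
  end.

(** One induction over the layers serves every regularity property. [T] is the cube, with fixed
    parameters, for measurability, and the set of pairs of parameters and points for boundedness and
    Lipschitz continuity. *)
Record sigmoid_closed (T : Type) (C : (T -> R) -> Prop) := SigmoidClosed {
  closed_cst : forall c, C (cst c) ;
  closedD : forall f g, C f -> C g -> C (fun t => f t + g t) ;
  closedM : forall f g, C f -> C g -> C (fun t => f t * g t) ;
  closed_sigmoid : forall f, C f -> C (fun t => sigmoid (f t)) }.

Section closed.
Variables (T : Type) (C : (T -> R) -> Prop).
Hypothesis HC : sigmoid_closed C.

Lemma closedB f g : C f -> C g -> C (fun t => f t - g t).
Proof.
move=> Cf Cg; rewrite (_ : (fun t => _) = (fun t => f t + (-1) * g t)).
  exact/(closedD HC Cf)/(closedM HC (closed_cst HC (-1)) Cg).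
by apply/funext => t; rewrite mulN1r.
Qed.

Lemma closedX2 f : C f -> C (fun t => f t ^+ 2).
Proof. by move=> Cf; apply: (closedM HC Cf Cf). Qed.

Lemma closed_sum n (f : 'I_n -> T -> R) :
  (forall i, C (f i)) -> C (fun t => \sum_(i < n) f i t).
Proof.
elim: n f => [|n IH] f Cf.
  rewrite (_ : (fun t => _) = cst 0); first exact: closed_cst.
  by apply/funext => t; rewrite big_ord0.
rewrite (_ : (fun t => _) = (fun t =>
    \sum_(i < n) f (widen_ord (leqnSn n) i) t + f ord_max t)).
  by apply: (closedD HC); [exact: (IH (fun i => f (widen_ord _ i)))|].
by apply/funext => t; rewrite big_ord_recr.
Qed.

Lemma closed_swish f : C f -> C (fun t => swish (f t)).
Proof. by move=> Cf; apply: (closedM HC Cf (closed_sigmoid HC Cf)). Qed.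

Lemma closed_dswish f : C f -> C (fun t => dswish (f t)).
Proof.
move=> Cf; have Cs := closed_sigmoid HC Cf.
apply: (closedD HC Cs); apply: (closedM HC Cf); apply: (closedM HC Cs).
exact: (closedB (closed_cst HC 1)).
Qed.

Lemma closed_mulmx m n (A : T -> 'M[R]_(m, n)) (x : T -> 'cV[R]_n) :
  (forall i j, C (fun t => A t i j)) -> (forall j, C (fun t => x t j ord0)) ->
  forall i, C (fun t => (A t *m x t) i ord0).
Proof.
move=> CA Cx i.
rewrite (_ : (fun t => _) = (fun t => \sum_(j < n) A t i j * x t j ord0)).
  apply: (closed_sum (f := fun j t => _)) => j; exact: (closedM HC).
by apply/funext => t; rewrite !mxE.
Qed.

Lemma closed_affine m n (A : T -> 'M[R]_(m, n)) (b : T -> 'cV[R]_m)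
    (x : T -> 'cV[R]_n) :
  (forall i j, C (fun t => A t i j)) -> (forall i, C (fun t => b t i ord0)) ->
  (forall j, C (fun t => x t j ord0)) ->
  forall i, C (fun t => (A t *m x t + b t) i ord0).
Proof.
move=> CA Cb Cx i; under eq_fun do rewrite mxE.
by apply: (closedD HC) => //; exact: closed_mulmx.
Qed.

(** The point [x] and the direction [v] vary with [t] as well, since past the first layer both
    depend on the parameters. *)
Lemma closed_nn (d : nat) (hidden : seq nat) (theta : T -> nn_param R d hidden)
    (x v : T -> 'cV[R]_d) :
  nn_entries C theta -> (forall i, C (fun t => x t i ord0)) ->
  (forall i, C (fun t => v t i ord0)) ->
  C (fun t => nn_eval (theta t) (x t)) /\
  C (fun t => nn_dir (theta t) (x t) (v t)).
Proof.
elim: hidden d theta x v => [|k hidden IH] d theta x v /=.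
  by move=> [CA Cb] Cx Cv; split; [exact: closed_affine|exact: closed_mulmx].
move=> [[CA Cb] Ctheta] Cx Cv.
have Cy := closed_affine CA Cb Cx.
apply: (IH _ (fun t => (theta t).2)) => // i.
  under eq_fun do rewrite mxE; exact: closed_swish.
under eq_fun do rewrite mxE.
by apply: (closedM HC); [exact: closed_dswish|exact: closed_mulmx].
Qed.

(** The square cancels the square root of [l2norm], which is not among the closure operations; a sum
    of squares of directional derivatives remains. *)
Lemma closed_energy (d : nat) (hidden : seq nat)
    (theta : T -> nn_param R d hidden) (x : T -> 'cV[R]_d) :
  nn_entries C theta -> (forall i, C (fun t => x t i ord0)) ->
  C (fun t => l2norm (grad (nn_eval (theta t)) (x t)) ^+ 2).
Proof.
move=> Ctheta Cx; rewrite (_ : (fun t => _) =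
    (fun t => \sum_(i < d) nn_dir (theta t) (x t) (delta_mx i ord0) ^+ 2)).
  apply: (closed_sum (f := fun i t => _)) => i; apply: closedX2.
  apply: (closed_nn (v := fun=> delta_mx i ord0) Ctheta Cx _).2 => j.
  exact: closed_cst.
apply/funext => t; rewrite /l2norm sqr_sqrtr ?sumr_ge0// => [|i _].
  by apply: eq_bigr => i _; rewrite grad_nn_eval.
exact: sqr_ge0.
Qed.

End closed.

Lemma sigmoid_closed_measurable (disp : measure_display)
    (T : measurableType disp) (D : set T) :
  sigmoid_closed (measurable_fun D : (T -> R) -> Prop).
Proof.
split=> [c|f g mf mg|f g mf mg|f mf].
- exact: measurable_cst.
- exact: measurable_funD.
- exact: measurable_funM.
rewrite /sigmoid.
(* The inverse of a positive number is written through [expR] and [ln], so that measurability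
   follows by composition. *)
rewrite (_ : (fun t => _) = (fun t => expR (- ln (1 + expR (- f t))))).
  apply: (measurableT_comp (@measurable_expR R)).
  apply: (@measurable_funN _ _ R D (fun t => ln (1 + expR (- f t)))).
  apply: (measurableT_comp (@measurable_ln R)).
  apply: measurable_funD; first exact: measurable_cst.
  apply: (measurableT_comp (@measurable_expR R)).
  exact: (@measurable_funN _ _ R D f).
by apply/funext => t; rewrite [RHS]expRN lnK// posrE sigmoid_den_gt0.
Qed.

(** Boundedness and the Lipschitz property travel together because a product inherits the second
    only in the presence of the first. The relation [close e] stands in for a distance at most [e],
    so no metric has to be put on the dependent type of parameters. *)
Definition bounded_lipschitz (T : Type) (D : set T)
    (close : R -> T -> T -> Prop) (f : T -> R) : Prop :=
  exists K L : R, [/\ 0 <= K, 0 <= L, forall t, D t -> `|f t| <= K &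
    forall e t t', 0 <= e -> D t -> D t' -> close e t t' ->
      `|f t - f t'| <= L * e].

Lemma sigmoid_closed_bounded_lipschitz (T : Type) (D : set T)
    (close : R -> T -> T -> Prop) :
  sigmoid_closed (bounded_lipschitz D close).
Proof.
split=> [c|f g|f g|f].
- exists `|c|, 0; split=> [||//|e t t' _ _ _ _] //.
  by rewrite subrr normr0 mul0r.
- move=> [K [L [K0 L0 fK fL]]] [K' [L' [K'0 L'0 gK gL]]].
  exists (K + K'), (L + L'); split=> [||t Dt|e t t' e0 Dt Dt' tt'];
    rewrite ?addr_ge0//.
    by rewrite (le_trans (ler_normD _ _))// lerD ?fK ?gK.
  rewrite opprD addrACA (le_trans (ler_normD _ _))// mulrDl.
  by rewrite lerD ?fL ?gL.
- move=> [K [L [K0 L0 fK fL]]] [K' [L' [K'0 L'0 gK gL]]].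
  exists (K * K'), (K * L' + K' * L); split=> [||t Dt|e t t' e0 Dt Dt' tt'];
    rewrite ?addr_ge0 ?mulr_ge0//.
    by rewrite normrM ler_pM ?fK ?gK.
  have -> : f t * g t - f t' * g t' =
    f t * (g t - g t') + g t' * (f t - f t') by ring.
  rewrite (le_trans (ler_normD _ _))// mulrDl !normrM -!mulrA.
  by rewrite lerD// ler_pM ?fK ?gK ?fL ?gL.
move=> [K [L [K0 L0 fK fL]]].
exists 1, L; split=> [||t Dt|e t t' e0 Dt Dt' tt'] //.
  exact: norm_sigmoid_le1.
exact/(le_trans (sigmoid_lipschitz _ _))/fL.
Qed.

Definition layer_close (e : R) (m n : nat)
    (l l' : 'M[R]_(m, n) * 'cV[R]_m) : Prop :=
  (forall i j, `|l.1 i j - l'.1 i j| <= e) /\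
  (forall i, `|l.2 i ord0 - l'.2 i ord0| <= e).

Fixpoint nn_close (e : R) (d : nat) (hidden : seq nat) :
    nn_param R d hidden -> nn_param R d hidden -> Prop :=
  match hidden return nn_param R d hidden -> nn_param R d hidden -> Prop with
  | [::] => fun theta theta' => layer_close e theta theta'
  | k :: hidden' => fun theta theta' =>
      layer_close e theta.1 theta'.1 /\ nn_close e theta.2 theta'.2
  end.

Lemma nn_entries_bounded_lipschitz (T : Type) (D : set T)
    (close : R -> T -> T -> Prop) (B : R) (d : nat) (hidden : seq nat)
    (theta : T -> nn_param R d hidden) :
  0 <= B ->
  (forall t, D t -> nn_bounded B (theta t)) ->
  (forall e t t', close e t t' -> nn_close e (theta t) (theta t')) ->
  nn_entries (bounded_lipschitz D close) theta.
Proof.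
move=> B0.
have entry (f : T -> R) : (forall t, D t -> `|f t| <= B) ->
    (forall e t t', close e t t' -> `|f t - f t'| <= e) ->
    bounded_lipschitz D close f.
  move=> fB fe; exists B, 1; split=> // e t t' _ _ _ /fe.
  by rewrite mul1r.
elim: hidden d theta => [|k hidden IH] d theta /= Dtheta close_theta.
  by split=> [i j|i]; apply: entry => [t /Dtheta[]|e t t' /close_theta[]].
split; last by apply: IH => [t /Dtheta[]|e t t' /close_theta[]].
by split=> [i j|i]; apply: entry => [t /Dtheta[[]]|e t t' /close_theta[[]]].
Qed.

Lemma nn_entries_cst (T : Type) (C : (T -> R) -> Prop) (d : nat)
    (hidden : seq nat) (theta : nn_param R d hidden) :
  (forall c, C (cst c)) -> nn_entries C (fun=> theta).
Proof.
move=> Ccst; elim: hidden d theta => [|k hidden IH] d theta /=.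
  by split=> *; exact: Ccst.
by split; [split=> *; exact: Ccst|exact: IH].
Qed.

(** * Finite nets in parameter space *)

Lemma interval_net (B : R) (m : nat) : 0 < B ->
  exists g : 'I_m.+1 -> R, (forall i, `|g i| <= B) /\
    forall x, `|x| <= B -> exists i, `|x - g i| <= 2 * B / m.+1%:R.
Proof.
move=> B0; pose s := 2 * B / m.+1%:R.
have s0 : 0 < s by rewrite divr_gt0 ?mulr_gt0.
have sm : s * m.+1%:R = 2 * B by rewrite /s divfK.
exists (fun i => - B + i%:R * s); split=> [i|x].
  have : i%:R <= m.+1%:R :> R by rewrite ler_nat ltnW.
  rewrite ler_norml => im.
  have : i%:R * s <= 2 * B by rewrite -sm mulrC ler_pM2l.
  have : 0 <= i%:R * s by rewrite mulr_ge0// ltW.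
  by lra.
rewrite ler_norml => /andP[Bx xB].
have q0 : 0 <= (x + B) / s by apply: divr_ge0; [lra|exact: ltW].
have [lt1 lt2] := andP (truncn_itv q0).
set k := Num.truncn _ in lt1 lt2.
have e1 : k%:R * s <= x + B by rewrite -ler_pdivlMr.
have e2 : x + B < k.+1%:R * s by rewrite -ltr_pdivrMr.
have [km|mk] := leqP k m.
  exists (Ordinal (km : (k < m.+1)%N)) => /=.
  move: e2; rewrite -natr1 mulrDl mul1r => e2.
  by rewrite -/s ler_norml; lra.
(* Truncation exceeds [m] only at the right end [x = B], which lies exactly one mesh width above the
   last grid point. *)
exists ord_max => /=; rewrite -/s.
have : m.+1%:R * s <= k%:R * s by rewrite ler_pM2r// ler_nat.
move: sm; rewrite mulrC => sm.
rewrite sm; move: sm; rewrite -natr1 mulrDl mul1r => sm kk.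
by rewrite ler_norml; lra.
Qed.

Lemma layer_net (B : R) (k d m : nat) : 0 < B ->
  exists (J : finType) (e : J -> 'M[R]_(k, d) * 'cV[R]_k),
  [/\ #|J| = (m.+1 ^ (k * d + k))%N, forall j, layer_bounded B (e j) &
    forall l, layer_bounded B l ->
      exists j, layer_close (2 * B / m.+1%:R) l (e j)].
Proof.
move=> B0; have [g [gB gnet]] := interval_net m B0.
exists ('M['I_m.+1]_(k, d) * 'cV['I_m.+1]_k)%type.
exists (fun M => (map_mx g M.1, map_mx g M.2)); split.
- by rewrite card_prod !card_mx card_ord muln1 expnD.
- by move=> M; split=> [i j|i]; rewrite mxE.
move=> l [lA lb].
(* With the bound on [x] inside the existential, the rounding map [r] is total and can be applied
   entrywise to matrices. *)
have /choice[r rP] x : exists i, `|x| <= B -> `|x - g i| <= 2 * B / m.+1%:R.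
  have [/gnet[i xi]|] := boolP (`|x| <= B); first by exists i.
  by exists ord0.
exists (map_mx r l.1, map_mx r l.2).
by split=> [i j|i]; rewrite !mxE rP.
Qed.

(** The exponent, the number of weights and biases, is fixed before the mesh: the size of the net is
    polynomial in [m], which the union bound relies on. *)
Lemma nn_net (B : R) (d : nat) (hidden : seq nat) : 0 < B ->
  exists D : nat, forall m : nat,
  exists (J : finType) (e : J -> nn_param R d hidden),
  [/\ #|J| = (m.+1 ^ D)%N, forall j, nn_bounded B (e j) &
    forall theta, nn_bounded B theta ->
      exists j, nn_close (2 * B / m.+1%:R) theta (e j)].
Proof.
move=> B0; elim: hidden d => [|k hidden IH] d /=.
  by exists (1 * d + 1)%N => m; exact: layer_net.
have [D IHD] := IH k; exists (k * d + k + D)%N => m.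
have [J [e [cJ eB enet]]] := layer_net k d m B0.
have [J' [e' [cJ' eB' enet']]] := IHD m.
exists (J * J')%type, (fun j => (e j.1, e' j.2)); split=> [|j|].
- by rewrite card_prod cJ cJ' -expnD.
- by split; [exact: eB|exact: eB'].
by move=> theta [/enet[j ej] /enet'[j' ej']]; exists (j, j').
Qed.

End network.

(** * Independence *)

Section integral_factor.
Context (disp disp' : measure_display) (W : measurableType disp)
  (V : measurableType disp') (R : realType) (P : {measure set W -> \bar R}).
Variables (Y : W -> R) (Z : W -> V) (a : R).
Hypotheses (mY : measurable_fun setT Y) (Y0 : forall w, 0 <= Y w)
  (mZ : measurable_fun setT Z).
Hypothesis YZ : forall B, measurable B ->
  (\int[P]_w (Y w * \1_B (Z w))%:E = a%:E * P (Z @^-1` B))%E.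

Import HBNNSimple.

Let mindicZ B : measurable B -> measurable_fun setT (fun w => \1_B (Z w) : R).
Proof.
by move=> mB; apply: measurableT_comp => //; exact: measurable_indic.
Qed.

Let nnsfun_factor (h : {nnsfun V >-> R}) :
  (\int[P]_w (Y w * h (Z w))%:E = a%:E * \int[P]_w (h (Z w))%:E)%E.
Proof.
have ind0 r w : 0 <= r * \1_(h @^-1` [set r]) (Z w).
  by have := nnfun_muleindic_ge0 h r (Z w); rewrite -EFinM lee_fin.
have hE w : h (Z w) = \sum_(r \in range h) r * \1_(h @^-1` [set r]) (Z w).
  exact: fimfunE.
have r_lt0 r w : r < 0 -> \1_(h @^-1` [set r]) (Z w) = 0 :> R.
  by move=> r0; rewrite preimage_nnfun0// indic0.
transitivity (\sum_(r \in range h)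
    \int[P]_w (Y w * (r * \1_(h @^-1` [set r]) (Z w)))%:E)%E.
  rewrite -ge0_integral_fsum//.
  - apply: eq_integral => w _.
    rewrite hE fsumEFin// fsbig_finite//= fsbig_finite//=.
    by rewrite big_distrr.
  - move=> r; apply/measurable_EFinP/measurable_funM => //.
    by apply: measurable_funM => //; exact: mindicZ.
  - by move=> r w _; rewrite lee_fin mulr_ge0.
transitivity (\sum_(r \in range h)
    a%:E * \int[P]_w (r * \1_(h @^-1` [set r]) (Z w))%:E)%E; last first.
  rewrite -ge0_mule_fsumr; last first.
    by move=> r; apply: integral_ge0 => w _; rewrite lee_fin.
  rewrite -ge0_integral_fsum//.
  - by congr (_ * _)%E; apply: eq_integral => w _; rewrite hE fsumEFin.
  - move=> r; apply/measurable_EFinP/measurable_funM => //.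
    exact: mindicZ.
  - by move=> r w _; rewrite lee_fin.
(* A negative [r] has an empty level set, so both sides vanish; a nonnegative one can be taken out
   of the integrals, which leaves an indicator and [YZ]. *)
apply: eq_fsbigr => r _; have [r0|r0] := ltP r 0.
  rewrite !integral0_eq ?mule0// => w _; rewrite r_lt0// mulr0 ?mulr0//.
under eq_integral do rewrite mulrCA EFinM.
rewrite ge0_integralZl//; last first.
- by move=> w _; rewrite lee_fin mulr_ge0.
- apply/measurable_EFinP/measurable_funM => //; exact: mindicZ.
under [in RHS]eq_integral do rewrite EFinM.
rewrite ge0_integralZl//; last first.
- exact/measurable_EFinP/mindicZ.
rewrite YZ// muleCA; congr (_ * (_ * _))%E.
rewrite [RHS](integral_indic P measurableT (A := Z @^-1` (h @^-1` [set r])))//.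
  by rewrite setIT.
by rewrite -[X in measurable X]setTI; exact: mZ.
Qed.

(** [YZ] is the case of indicators. Linearity extends it to simple functions, and monotone
    convergence along an increasing approximation of [phi] does the rest. *)
Lemma ge0_integral_factor (phi : V -> R) :
  measurable_fun setT phi -> (forall x, 0 <= phi x) ->
  (\int[P]_w (Y w * phi (Z w))%:E = a%:E * \int[P]_w (phi (Z w))%:E)%E.
Proof.
move=> mphi phi0.
have mf : measurable_fun setT (EFin \o phi) by exact/measurable_EFinP.
pose g := nnsfun_approx measurableT mf.
have gphi x : (fun n => (g n x)%:E) @ \oo --> (phi x)%:E.
  by apply: (cvg_nnsfun_approx measurableT mf) => // y _; rewrite lee_fin.
have ndg x : nondecreasing_seq (fun n => (g n x)%:E).
  by move=> m n mn; rewrite lee_fin; exact/lefP/nd_nnsfun_approx.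
have mgZ n : measurable_fun setT (fun w => g n (Z w)).
  exact: measurableT_comp.
have lim1 : (\int[P]_w (g n (Z w))%:E @[n --> \oo] -->
    \int[P]_w (phi (Z w))%:E)%E.
  rewrite (_ : (\int[P]_w (phi (Z w))%:E)%E =
      (\int[P]_w limn (fun n => (g n (Z w))%:E))%E).
    apply: cvg_monotone_convergence => [//|n|n w _|w _]; last exact: ndg.
      exact/measurable_EFinP.
    by rewrite lee_fin.
  by apply: eq_integral => w _; apply/esym/cvg_lim => //; exact: gphi.
have lim2 : (\int[P]_w (Y w * g n (Z w))%:E @[n --> \oo] -->
    \int[P]_w (Y w * phi (Z w))%:E)%E.
  rewrite (_ : (\int[P]_w (Y w * phi (Z w))%:E)%E =
      (\int[P]_w limn (fun n => (Y w * g n (Z w))%:E))%E).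
    apply: cvg_monotone_convergence => [//|n|n w _|w _ m n mn].
    - exact/measurable_EFinP/measurable_funM.
    - by rewrite lee_fin mulr_ge0.
    - by rewrite lee_fin ler_wpM2l// -lee_fin; exact: ndg.
  apply: eq_integral => w _; apply/esym/cvg_lim => //.
  under eq_fun do rewrite EFinM.
  by rewrite EFinM; apply: cvgeZl => //; exact: gphi.
apply: (cvg_unique _ lim2); first exact: ereal_hausdorff.
rewrite (_ : (fun n => _) = (fun n => a%:E * \int[P]_w (g n (Z w))%:E)%E).
  exact: cvgeZl.
by apply/funext => n; exact: nnsfun_factor.
Qed.

End integral_factor.

Section independence.
Context (R : realType) (disp : measure_display) (W : measurableType disp)
  (P : probability W R) (d : nat) (X : nat -> W -> 'cV[R]_d).
Hypotheses (mX : forall j, measurable_fun setT (X j))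
  (indepX : mutually_independent P X).

Let preimage_measurable (j : nat) (A : set 'cV[R]_d) :
  measurable A -> measurable (X j @^-1` A).
Proof. by move=> mA; rewrite -[X in measurable X]setTI; exact: mX. Qed.

Let integral_prod_indic (t : seq nat) (A : nat -> set 'cV[R]_d) (p : nat -> R) :
  uniq t -> (forall j, measurable (A j)) ->
  (forall j, P (X j @^-1` A j) = (p j)%:E) ->
  (\int[P]_w (\prod_(j <- t) \1_(A j) (X j w))%:E = (\prod_(j <- t) p j)%:E)%E.
Proof.
move=> ut mA pA.
have -> : (\prod_(j <- t) p j)%:E = (\prod_(j <- t) P (X j @^-1` A j))%E.
  by elim: {ut} t => [|j t IH]; rewrite ?big_nil// !big_cons EFinM IH pA.
rewrite -indepX// -[X in P X]setIT -integral_indic//; last first.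
  by apply: fin_bigcap_measurable => // j _; exact: preimage_measurable.
apply: eq_integral => w _; congr (_%:E).
rewrite bigcap_seq; elim: t {ut} => [|j t IH].
  by rewrite !big_nil indicT.
by rewrite !big_cons IH indicI.
Qed.

(** The mixed form, functions on [s] and indicators on [t], makes the induction on [s] work: to
    split off [phi k], [ge0_integral_factor] asks for the formula with an indicator of [X k] in its
    place, and this is the induction hypothesis for [k :: t]. *)
Let integral_prod_indep_indic (s t : seq nat) (phi : nat -> 'cV[R]_d -> R)
    (c : nat -> R) (A : nat -> set 'cV[R]_d) (p : nat -> R) :
  uniq (s ++ t) ->
  (forall j, measurable_fun setT (phi j)) -> (forall j x, 0 <= phi j x) ->
  (forall j, \int[P]_w (phi j (X j w))%:E = (c j)%:E)%E ->
  (forall j, measurable (A j)) ->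
  (forall j, P (X j @^-1` A j) = (p j)%:E) ->
  (\int[P]_w (\prod_(j <- s) phi j (X j w) *
              \prod_(j <- t) \1_(A j) (X j w))%:E
   = (\prod_(j <- s) c j * \prod_(j <- t) p j)%:E)%E.
Proof.
move=> + mphi phi0 phic.
elim: s t A p => [|k s IH] t A p /= ust mA pA.
  under eq_integral do rewrite big_nil mul1r.
  by rewrite big_nil mul1r; exact: integral_prod_indic.
have /andP[kst ust'] := ust.
have c0 j : 0 <= c j.
  by rewrite -lee_fin -phic; apply: integral_ge0 => w _; rewrite lee_fin.
have p0 j : 0 <= p j by rewrite -lee_fin -pA.
have kt j : j \in t -> j != k.
  by move=> jt; apply: contraNneq kst => <-; rewrite mem_cat jt orbT.
set Y := fun w => \prod_(j <- s) phi j (X j w) *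
  \prod_(j <- t) \1_(A j) (X j w).
pose a := \prod_(j <- s) c j * \prod_(j <- t) p j.
transitivity (\int[P]_w (Y w * phi k (X k w))%:E)%E.
  apply: eq_integral => w _; congr (_%:E).
  by rewrite big_cons /Y -mulrA mulrC.
rewrite (@ge0_integral_factor _ _ W _ R P Y (X k) a) //.
- by rewrite phic -EFinM /a big_cons; congr EFin; ring.
- apply: measurable_funM; apply: measurable_prod => j _.
    exact: measurableT_comp.
  by apply: measurableT_comp => //; exact: measurable_indic.
- by move=> w; rewrite /Y mulr_ge0 ?prodr_ge0.
move=> B mB.
(* The families are overridden at [k] alone; since [k] does not occur in [t], the indicators already
   present stay unchanged. *)
pose A' j := if j == k then B else A j.
pose p' j := if j == k then fine (P (X k @^-1` B)) else p j.
have ut' : uniq (s ++ k :: t).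
  by rewrite -(perm_uniq (permEl (perm_catCA [:: k] s t))).
have mA' j : measurable (A' j) by rewrite /A'; case: ifP.
have pA' j : P (X j @^-1` A' j) = (p' j)%:E.
  rewrite /A' /p'; case: eqP => [->|//]; rewrite fineK//.
  exact/fin_num_measure/preimage_measurable.
have := IH (k :: t) A' p' ut' mA' pA'.
have -> : \prod_(j <- k :: t) p' j =
    fine (P (X k @^-1` B)) * \prod_(j <- t) p j.
  rewrite big_cons {1}/p' eqxx; congr (_ * _).
  by rewrite !big_seq; apply: eq_bigr => j /kt; rewrite /p' => /negPf ->.
rewrite mulrCA mulrC EFinM fineK; last first.
  exact/fin_num_measure/preimage_measurable.
move=> <-; apply: eq_integral => w _; congr (_%:E).
have A'k : A' k = B by rewrite /A' eqxx.
rewrite big_cons A'k /Y.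
have -> : \prod_(j <- t) \1_(A' j) (X j w) =
    \prod_(j <- t) \1_(A j) (X j w) :> R.
  by rewrite !big_seq; apply: eq_bigr => j /kt; rewrite /A' => /negPf ->.
by rewrite mulrCA mulrC.
Qed.

Lemma integral_prod_indep (s : seq nat) (phi : nat -> 'cV[R]_d -> R)
    (c : nat -> R) :
  uniq s ->
  (forall j, measurable_fun setT (phi j)) -> (forall j x, 0 <= phi j x) ->
  (forall j, \int[P]_w (phi j (X j w))%:E = (c j)%:E)%E ->
  (\int[P]_w (\prod_(j <- s) phi j (X j w))%:E = (\prod_(j <- s) c j)%:E)%E.
Proof.
move=> us mphi phi0 phic.
have := @integral_prod_indep_indic s [::] phi c (fun=> setT) (fun=> 1).
rewrite cats0 big_nil mulr1 => <- //.
  by apply: eq_integral => w _; rewrite big_nil mulr1.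
by move=> j; rewrite preimage_setT probability_setT.
Qed.

End independence.

(** * Sampling from the cube *)

Section cube.
Variables (R : realType) (d : nat).

Lemma measurable_cube : measurable (@cube R d).
Proof.
rewrite (_ : cube = \bigcap_(i in [set: 'I_d])
    vec_coord i @^-1` `[0, 1]%classic).
  apply: fin_bigcap_measurable => // i _.
  by rewrite -[X in measurable X]setTI; exact: measurable_vec_coord.
apply/seteqP; split => x /= Bx i.
  by move=> _; rewrite /= in_itv/=; exact: Bx.
by have := Bx i I; rewrite /= in_itv.
Qed.

Lemma lebesgue_rd_cube : lebesgue_rd R d cube = 1%E.
Proof.
have := @lebesgue_rd_box R d (fun=> 0) (fun=> 1) (fun=> ler01).
rewrite -/(@cube R d) => ->.
by rewrite big1// => i _; rewrite subr0.
Qed.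

Lemma bounded_integrable_cube (h : 'cV[R]_d -> R) (K : R) :
  measurable_fun cube h -> (forall x, cube x -> `|h x| <= K) ->
  (lebesgue_rd R d).-integrable cube (EFin \o h).
Proof.
move=> mh hK; apply: measurable_bounded_integrable => //.
- exact: measurable_cube.
- apply: (@le_lt_trans _ _ 1%E); last exact: ltry.
  by rewrite le_eqVlt; apply/orP; left; apply/eqP; exact: lebesgue_rd_cube.
exists K; split; first exact: num_real.
by move=> y Ky x /hK/le_trans; apply; exact: ltW.
Qed.

Lemma Rintegral_cube_cst (c : R) : \int[lebesgue_rd R d]_(x in cube) c = c.
Proof.
rewrite Rintegral_cst; last exact: measurable_cube.
set v := (X in fine X); have -> : v = 1%E by exact: lebesgue_rd_cube.
by rewrite mulr1.
Qed.

Lemma norm_Rintegral_cube_le (h : 'cV[R]_d -> R) (K : R) :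
  measurable_fun cube h -> (forall x, cube x -> `|h x| <= K) ->
  `|\int[lebesgue_rd R d]_(x in cube) h x| <= K.
Proof.
move=> mh hK; have ih := bounded_integrable_cube mh hK.
have mcube := measurable_cube.
apply: le_trans (le_normr_Rintegral mcube ih) _.
rewrite -[leRHS]Rintegral_cube_cst; apply: le_Rintegral => //.
- exact: integrable_norm.
- apply: (@bounded_integrable_cube _ `|K|) => //; exact: measurable_cst.
Qed.

End cube.

(** From [1 - x <= exp (- x)] comes [(1 - x) * exp x <= 1], and [(1 - x) * (1 + x + 2 * x ^+ 2) = 1
    + x ^+ 2 * (1 - 2 * x)] is at least 1 for [x <= 1/2]. *)
Lemma expR_le_quadratic (R : realType) (x : R) :
  `|x| <= 2^-1 -> expR x <= 1 + x + 2 * x ^+ 2.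
Proof.
rewrite ler_norml => /andP[x1 x2].
have e0 := expR_gt0 x.
have : (1 - x) * expR x <= 1.
  rewrite -[leRHS](expRxMexpNx_1 x) mulrC ler_pM2l//; exact: expR_ge1Dx.
have : expR x * (1 - x) * (1 + x + 2 * x ^+ 2) >= expR x.
  rewrite -mulrA ler_peMr ?(ltW e0)//.
  have -> : (1 - x) * (1 + x + 2 * x ^+ 2) = 1 + x ^+ 2 * (1 - 2 * x) by ring.
  by rewrite lerDl mulr_ge0 ?sqr_ge0//; lra.
move=> h1 h2; apply: le_trans h1 _.
rewrite mulrC [expR x * _]mulrC ler_piMr//.
have := sqr_ge0 x; lra.
Qed.

(** * Exponential moments of centred sample sums *)

Section sample_moments.
Context (R : realType) (disp : measure_display) (W : measurableType disp)
  (P : probability W R) (d : nat) (X : nat -> W -> 'cV[R]_d).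
Hypothesis hX : iid_uniform P X.
Local Notation mu := (lebesgue_rd R d).

Lemma ge0_integral_sample (h : 'cV[R]_d -> R) (j : nat) :
  measurable_fun cube h -> (forall x, cube x -> 0 <= h x) ->
  (\int[P]_w (h (X j w))%:E = \int[mu]_(x in cube) (h x)%:E)%E.
Proof.
case: hX => mX cX uX _ mh h0.
have mcube := @measurable_cube R d.
have -> : (\int[P]_w (h (X j w))%:E =
    \int[pushforward P (X j)]_(x in cube) (h x)%:E)%E.
  rewrite ge0_integral_pushforward//.
  - by congr (integral _ _ _); apply/seteqP; split=> w // _; exact: cX.
  - exact/measurable_EFinP.
  - by move=> x /[!inE] cx; rewrite lee_fin h0.
apply: eq_measure_integral => A mA Ac.
rewrite -[RHS](_ : mu (A `&` cube) = _); first exact: uX.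
by congr (mu _); exact/setIidPl.
Qed.

Lemma measurable_sample (h : 'cV[R]_d -> R) (j : nat) :
  measurable_fun cube h -> measurable_fun setT (fun w => h (X j w)).
Proof.
case: hX => mX cX _ _ mh.
apply: (@measurable_comp _ _ _ _ _ _ cube) => //; first exact: measurable_cube.
by move=> _ [w _ <-]; exact: cX.
Qed.

(** Centring kills the linear term of the quadratic bound, and [1 + q <= exp q] turns what remains
    into a form that multiplies well over the sample. The factor [2 * K] bounds [h - m]. The moment
    is named as a real [c] for use in the product formula. *)
Lemma exp_moment1 (h : 'cV[R]_d -> R) (K s : R) (j : nat)
    (m := \int[mu]_(x in cube) h x) :
  measurable_fun cube h -> (forall x, cube x -> `|h x| <= K) ->
  `|s| * (2 * K) <= 2^-1 ->
  exists2 c : R, (\int[P]_w (expR (s * (h (X j w) - m)))%:E = c%:E)%E &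
    c <= expR (2 * (s * (2 * K)) ^+ 2).
Proof.
move=> mh hK sK.
have mcube := @measurable_cube R d.
have mK : `|m| <= K by exact: norm_Rintegral_cube_le.
have hmK x : cube x -> `|s * (h x - m)| <= `|s| * (2 * K).
  move=> /hK hx; rewrite normrM ler_wpM2l//.
  by rewrite (le_trans (ler_normB _ _))// mulrDl mul1r lerD.
have ms : measurable_fun cube (fun x => s * (h x - m)).
  apply: measurable_funM; first exact: measurable_cst.
  by apply: measurable_funB => //; exact: measurable_cst.
have me : measurable_fun cube (fun x => expR (s * (h x - m))).
  exact: (measurableT_comp (@measurable_expR R) ms).
have eb x : cube x -> `|expR (s * (h x - m))| <= expR 2^-1.
  move=> /hmK hx; rewrite ger0_norm ?expR_ge0// ler_expR.
  exact/(le_trans _ sK)/(le_trans (ler_norm _)).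
have ie := bounded_integrable_cube me eb.
exists (\int[mu]_(x in cube) expR (s * (h x - m))).
  rewrite (ge0_integral_sample (h := fun x => expR (s * (h x - m))))//.
  by rewrite /Rintegral fineK//; exact: integrable_fin_num.
set q := 2 * (s * (2 * K)) ^+ 2.
have ih := bounded_integrable_cube mh hK.
have icst c : mu.-integrable cube (EFin \o (cst c : 'cV[R]_d -> R)).
  by apply: (@bounded_integrable_cube _ _ _ `|c|) => //; exact: measurable_cst.
have is_ : mu.-integrable cube (EFin \o (fun x => s * (h x - m))).
  exact: bounded_integrable_cube hmK.
apply: (@le_trans _ _ (\int[mu]_(x in cube) ((1 + q) + s * (h x - m)))).
  apply: le_Rintegral => //.
    exact: (integrableD mcube (icst (1 + q)) is_).
  move=> x /hmK hx.
  apply: le_trans (expR_le_quadratic (le_trans hx sK)) _.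
  rewrite addrAC lerD2r lerD2l /q ler_wpM2l//.
  rewrite -real_normK ?num_real// -[leRHS]real_normK ?num_real//.
  rewrite lerXn2r ?nnegrE//; apply: le_trans hx _.
  by rewrite normrM ler_wpM2l// ler_norm.
rewrite RintegralD//=; last exact: icst.
rewrite Rintegral_cube_cst RintegralZl//; last first.
  exact: (integrableB mcube ih (icst m)).
rewrite RintegralB//; last exact: icst.
by rewrite Rintegral_cube_cst subrr mulr0 addr0 expR_ge1Dx.
Qed.

Lemma exp_moment (h : 'cV[R]_d -> R) (K s : R) (n : nat)
    (m := \int[mu]_(x in cube) h x) :
  measurable_fun cube h -> (forall x, cube x -> `|h x| <= K) ->
  `|s| * (2 * K) <= 2^-1 ->
  (\int[P]_w (expR (s * \sum_(j < n) (h (X j w) - m)))%:E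
   <= (expR (2 * n%:R * (s * (2 * K)) ^+ 2))%:E)%E.
Proof.
move=> mh hK sK.
have /choice[c cP] j : exists c : R,
    (\int[P]_w (expR (s * (h (X j w) - m)))%:E = c%:E)%E /\
    c <= expR (2 * (s * (2 * K)) ^+ 2).
  by have [c ? ?] := exp_moment1 j mh hK sK; exists c.
case: hX => mX cX uX iX.
have mcube := @measurable_cube R d.
(* [h] is controlled on the cube only, while the product formula takes functions measurable on the
   whole space; extension by zero changes nothing at the sample points. *)
pose phi (j : nat) x : R := if x \in cube then expR (s * (h x - m)) else 0.
have phiX j w : phi j (X j w) = expR (s * (h (X j w) - m)).
  by rewrite /phi mem_set//; exact: cX.
have -> : (\int[P]_w (expR (s * \sum_(j < n) (h (X j w) - m)))%:E
    = \int[P]_w (\prod_(j <- index_iota 0 n) phi j (X j w))%:E)%E.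
  apply: eq_integral => w _; congr (_%:E).
  rewrite mulr_sumr expR_sum big_mkord.
  by apply: eq_bigr => j _; rewrite phiX.
rewrite (integral_prod_indep mX iX (c := c)).
- rewrite lee_fin -mulrA mulrCA expRM_natl big_mkord.
  rewrite -[n in leRHS]card_ord -prodr_const; apply: ler_prod => j _.
  have [cj ->] := cP j; rewrite andbT -lee_fin -cj.
  by apply: integral_ge0 => w _; rewrite lee_fin expR_ge0.
- exact: iota_uniq.
- move=> j.
  rewrite (_ : phi j = (fun x => expR (s * (h x - m))) \_ cube); last first.
    by apply/funext => x; rewrite /phi patchE.
  apply/(measurable_restrictT (fun x => expR (s * (h x - m))) mcube).
  have ms : measurable_fun cube (fun x => s * (h x - m)).
    apply: measurable_funM; first exact: measurable_cst.
    by apply: measurable_funB => //; exact: measurable_cst.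
  exact: (measurableT_comp (@measurable_expR R) ms).
- by move=> j x; rewrite /phi; case: ifP => // _; exact: expR_ge0.
- move=> j; have [<- _] := cP j; apply: eq_integral => w _; by rewrite phiX.
Qed.

End sample_moments.

(** * Deviation uniform over a polynomial net *)

Section rate.
Variable R : realType.

Definition rate (n : nat) : R := n%:R `^ (- 2^-1) * ln n%:R `^ 2^-1.

Variable n : nat.
Hypothesis n2 : (2 <= n)%N.

(** Lets additive constants be absorbed into [ln n]. It reduces to [exp (1/2) <= 2], that is,
    [1 - 1/2 <= exp (- 1/2)]. *)
Lemma ln_ge_half : 2^-1 <= ln (n%:R : R).
Proof.
have e2 : expR (2^-1 : R) <= 2.
  rewrite -[2^-1]opprK expRN -[leRHS]invrK lef_pV2 ?posrE ?expR_gt0//.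
  by apply: le_trans (expR_ge1Dx _); lra.
rewrite -[leLHS](@expRK R) ler_ln ?posrE ?expR_gt0 ?ltr0n ?(leq_trans _ n2)//.
by apply: le_trans e2 _; rewrite ler_nat.
Qed.

Lemma rate_sqr : n%:R * rate n ^+ 2 = ln (n%:R : R).
Proof.
have n0 : 0 < (n%:R : R) by rewrite ltr0n (leq_trans _ n2).
have l0 : 0 <= ln (n%:R : R) by apply: le_trans ln_ge_half.
rewrite /rate powRN !powR12_sqrt ?(ltW n0)//.
rewrite exprMn exprVn !sqr_sqrtr ?(ltW n0)//.
by rewrite mulrA divff ?gt_eqF// mul1r.
Qed.

Lemma rate_gt0 : 0 < rate n.
Proof.
apply: mulr_gt0; apply: powR_gt0; first by rewrite ltr0n (leq_trans _ n2).
by apply: lt_le_trans ln_ge_half.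
Qed.

Lemma rate_le1 : rate n <= 1.
Proof.
have n0 : 0 < (n%:R : R) by rewrite ltr0n (leq_trans _ n2).
rewrite -(@ler_pXn2r _ 2%N)// ?nnegrE ?(ltW rate_gt0)// expr1n.
by rewrite -(ler_pM2l n0) rate_sqr mulr1 ltW// ln_sublinear.
Qed.

(** Puts the discretization error of a mesh of order [1/n] below the rate:
    [2 * n * rate n ^+ 2 = 2 * ln n] is at least 1, and [rate n <= 1]. *)
Lemma invn_le_rate : n%:R^-1 <= 2 * rate n.
Proof.
have n0 : 0 < (n%:R : R) by rewrite ltr0n (leq_trans _ n2).
apply: (@le_trans _ _ (2 * rate n ^+ 2)).
  rewrite -(ler_pM2l n0) mulfV ?gt_eqF// mulrCA rate_sqr.
  by have := ln_ge_half; lra.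
rewrite ler_pM2l// expr2 ler_piMl ?rate_le1//; exact: ltW rate_gt0.
Qed.

End rate.

Section uniform_deviation.
Context (R : realType) (disp : measure_display) (W : measurableType disp)
  (P : probability W R) (d : nat) (X : nat -> W -> 'cV[R]_d).
Hypothesis hX : iid_uniform P X.
Local Notation mu := (lebesgue_rd R d).
Variables (Theta : Type) (S : set Theta) (close : R -> Theta -> Theta -> Prop).
Variables (D : nat) (b : R).
Hypothesis b0 : 0 <= b.
Hypothesis net : forall m, exists (J : finType) (e : J -> Theta),
  [/\ #|J| = (m.+1 ^ D)%N, forall j, S (e j) &
    forall theta, S theta -> exists j, close (b / m.+1%:R) theta (e j)].
Variables (h : Theta -> 'cV[R]_d -> R) (K L : R).
Hypotheses (K0 : 0 <= K) (L0 : 0 <= L)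
  (mh : forall theta, S theta -> measurable_fun cube (h theta))
  (hK : forall theta x, S theta -> cube x -> `|h theta x| <= K)
  (hL : forall e theta theta' x, 0 <= e -> S theta -> S theta' ->
    close e theta theta' -> cube x -> `|h theta x - h theta' x| <= L * e).

Definition deviation (n : nat) (theta : Theta) (w : W) : R :=
  \int[mu]_(x in cube) h theta x - n%:R^-1 * \sum_(j < n) h theta (X j w).

Let center theta := \int[mu]_(x in cube) h theta x.

Let deviationE n theta w : (0 < n)%N ->
  deviation n theta w =
    - (n%:R^-1 * \sum_(j < n) (h theta (X j w) - center theta)).
Proof.
move=> n0; rewrite /deviation -/(center theta) sumrB sumr_const card_ord mulrBr.
rewrite -[center theta *+ n]mulr_natl mulrA mulVf ?mul1r ?opprB//.
by rewrite pnatr_eq0 -lt0n.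
Qed.

Let deviation_lipschitz n e theta theta' w : (0 < n)%N -> 0 <= e ->
  S theta -> S theta' -> close e theta theta' ->
  `|deviation n theta w| <= `|deviation n theta' w| + 2 * (L * e).
Proof.
move=> n0 e0 St St' tt'.
case: (hX) => _ cX _ _.
have mcube := @measurable_cube R d.
have -> : deviation n theta w = deviation n theta' w +
   ((center theta - center theta') +
     n%:R^-1 * \sum_(j < n) (h theta' (X j w) - h theta (X j w))).
  by rewrite /deviation -/(center _) -/(center _) sumrB; ring.
apply: le_trans (ler_normD _ _) _; rewrite lerD2l.
apply: le_trans (ler_normD _ _) _.
have -> : 2 * (L * e) = L * e + L * e by ring.
have i1 t : S t -> mu.-integrable cube (EFin \o h t).
  move=> St1; apply: (@bounded_integrable_cube _ _ _ K) => [|x].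
    exact: mh.
  exact: hK.
apply: lerD.
  rewrite /center -RintegralB//; [|exact: i1|exact: i1].
  apply: norm_Rintegral_cube_le => [|x cx]; last exact: hL.
  by apply: measurable_funB; exact: mh.
rewrite normrM ger0_norm ?invr_ge0// ler_pdivrMl ?ltr0n//.
apply: le_trans (ler_norm_sum _ _ _) _.
rewrite mulr_natl -[n in leRHS]card_ord -sumr_const.
by apply: ler_sum => j _; rewrite distrC hL.
Qed.

Lemma uniform_deviation : exists2 lambda : R, 0 < lambda &
  forall n, (2 <= n)%N -> exists G : W -> R,
  [/\ measurable_fun setT G, forall w, 0 <= G w,
    forall theta w, S theta -> `|deviation n theta w| <= G w &
    (\int[P]_w (G w)%:E <= (lambda * rate R n)%:E)%E].
Proof.
(* [K + 1] in place of [K] keeps [M], by which [s] is divided, positive when [K = 0]. *)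
pose M := 2 * (K + 1).
have M0 : 0 < M by rewrite mulr_gt0// ltr_wpDl.
(* The term [4 * (L * b)] comes from [2 * L * b / n] and [invn_le_rate]. The other is
   [(a + 1) / (s * n)] below: [a + 1 <= (D + 4) * ln n] because [ln n >= 1/2], and
   [ln n / (s * n) = 2 * M * r]. *)
exists (2 * M * (D%:R + 4) + 4 * (L * b)) => [|n n2].
  by rewrite ltr_wpDr ?mulr_ge0 ?mulr_gt0// ltr_wpDl.
have n0 : 0 < (n%:R : R) by rewrite ltr0n (leq_trans _ n2).
have lnn := ln_ge_half R n2.
set r := rate R n; have r0 : 0 < r := rate_gt0 R n2.
have r1 : r <= 1 := rate_le1 R n2.
have nr : n%:R * r ^+ 2 = ln n%:R := rate_sqr R n2.
(* Then [s * M = r / 2 <= 1/2], as [exp_moment] demands, and [n * (s * M) ^+ 2] is still of order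
   [ln n]. *)
pose s := r / (2 * M).
have n1 : n.-1.+1 = n by rewrite prednK// (leq_trans _ n2).
have s0 : 0 < s by apply: divr_gt0 => //; apply: mulr_gt0.
have sM : s * M = r / 2.
  by rewrite /s; field; rewrite gt_eqF.
(* Index [n - 1] gives mesh exactly [b / n] and [n ^ D] points. *)
have [J [e [cJ eS enet]]] := net n.-1.
rewrite n1 in cJ enet.
pose T j w := \sum_(k < n) (h (e j) (X k w) - center (e j)).
pose a := (D%:R + 2) * ln n%:R : R.
(* Union bound through [t <= a + exp (t - a)]: each of the n^D terms of [Q] has
   mean O(n), and [exp (- a) = n ^ - (D + 2)] compensates for their sum. *)
pose Q w := \sum_j (expR (s * T j w) + expR (- s * T j w)).
(* The first summand pays for moving [theta] to the net, in the integral and in the average; the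
   second bounds the average deviation at every net point. *)
exists (fun w => 2 * (L * (b / n%:R)) + (s * n%:R)^-1 * (a + expR (- a) * Q w)).
have a0 : 0 <= a by rewrite mulr_ge0 ?addr_ge0//; lra.
have Q0 w : 0 <= Q w by apply: sumr_ge0 => j _; rewrite addr_ge0 ?expR_ge0.
have c0 : 0 <= 2 * (L * (b / n%:R)).
  by do 2 apply: mulr_ge0 => //; rewrite divr_ge0.
have sn0 : 0 < (s * n%:R)^-1 by rewrite invr_gt0 mulr_gt0.
have mexp c j : measurable_fun setT (fun w => expR (c * T j w)).
  apply: (measurableT_comp (@measurable_expR R)).
  apply: measurable_funM; first exact: measurable_cst.
  apply: measurable_sum => k.
  apply: measurable_funB; last exact: measurable_cst.
  exact: (measurable_sample hX k (mh (eS j))).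
have mQ : measurable_fun setT Q.
  by apply: measurable_sum => j; apply: measurable_funD; exact: mexp.
split.
- apply: measurable_funD; first exact: measurable_cst.
  apply: measurable_funM; first exact: measurable_cst.
  apply: measurable_funD; first exact: measurable_cst.
  by apply: measurable_funM; first exact: measurable_cst.
- move=> w; apply: addr_ge0 => //; apply: mulr_ge0; first exact: ltW.
  by apply: addr_ge0 => //; apply: mulr_ge0 => //; exact: expR_ge0.
- move=> theta w St.
  have [j ej] := enet theta St.
  have n0' : (0 < n)%N by rewrite (leq_trans _ n2).
  have bn0 : 0 <= b / n%:R by rewrite divr_ge0.
  apply: le_trans (deviation_lipschitz w n0' bn0 St (eS j) ej) _.
  rewrite addrC lerD2l deviationE// normrN normrM.
  rewrite ger0_norm ?invr_ge0 ?(ltW n0)//.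
  rewrite -/(T j w).
  rewrite (_ : n%:R^-1 * _ = (s * n%:R)^-1 * (s * `|T j w|)); last first.
    by field; rewrite !gt_eqF.
  rewrite ler_pM2l//.
  have Qj : expR (s * T j w) + expR (- s * T j w) <= Q w.
    rewrite /Q (bigD1 j)//= lerDl.
    by apply: sumr_ge0 => i _; rewrite addr_ge0 ?expR_ge0.
  have key t : expR t <= Q w -> t <= a + expR (- a) * Q w.
    move=> tQ; have : expR (- a) * expR t <= expR (- a) * Q w.
      by rewrite ler_pM2l// expR_gt0.
    by rewrite -expRD; have := expR_ge1Dx (- a + t); lra.
  have e1 := expR_ge0 (s * T j w); have e2 := expR_ge0 (- s * T j w).
  rewrite -[s in s * _](ger0_norm (ltW s0)) -normrM ler_norml -lerN2 opprK.
  by rewrite -mulNr; apply/andP; split; apply: key; lra.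
have iexp c j : `|c| = s ->
    (\int[P]_w (expR (c * T j w))%:E <= (n%:R)%:E)%E.
  move=> cs.
  have := @exp_moment _ _ _ P _ _ hX (h (e j)) (K + 1) c n (mh (eS j)).
  rewrite -/M -/(center _) => /(_ _ _)/le_trans; apply.
  - by move=> x cx; rewrite (le_trans (hK (eS j) cx))// lerDl.
  - by rewrite cs sM; lra.
  (* The exponent is [2 * n * (r / 2) ^+ 2], half of [ln n], so the moment is at most [n]. *)
  rewrite lee_fin -[leRHS]lnK ?posrE// ler_expR -nr exprMn.
  rewrite -[c ^+ 2]real_normK ?num_real// cs -exprMn sM exprMn.
  have : 0 <= n%:R * r ^+ 2 by rewrite mulr_ge0 ?sqr_ge0 ?(ltW n0).
  rewrite expr2; lra.
have mEQ c j : measurable_fun setT (fun w => (expR (c * T j w))%:E).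
  exact/measurable_EFinP/mexp.
have iQ : (\int[P]_w (Q w)%:E <= (#|J|%:R * (2 * n%:R))%:E)%E.
  rewrite (_ : (\int[P]_w (Q w)%:E)%E =
    (\sum_(j : J) \int[P]_w (expR (s * T j w) + expR (- s * T j w))%:E)%E).
    rewrite (_ : (_ * _)%:E = (\sum_(j : J) (2 * n%:R)%:E)%E); last first.
      by rewrite sumEFin sumr_const mulr_natl.
    apply: lee_sum => j _; under eq_integral do rewrite EFinD.
    rewrite ge0_integralD//.
    - rewrite (_ : (2 * n%:R)%:E = (n%:R%:E + n%:R%:E)%E); last first.
        by rewrite -EFinD; congr EFin; ring.
      by apply: leeD; apply: iexp; rewrite ?normrN gtr0_norm.
  rewrite -ge0_integral_sum//.
  - by apply: eq_integral => w _; rewrite sumEFin.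
  - by move=> j; apply/measurable_EFinP/measurable_funD; exact: mexp.
have QB : expR (- a) * (#|J|%:R * (2 * n%:R)) <= 1.
  have -> : #|J|%:R = expR (D%:R * ln n%:R) :> R.
    by rewrite cJ natrX expRM_natl lnK ?posrE.
  have -> : expR (- a) = expR (- (D%:R * ln n%:R)) * n%:R ^- 2.
    rewrite -[X in _ * X ^- 2](@lnK R) ?posrE// -expRM_natl -expRN -expRD.
    by congr expR; rewrite /a; ring.
  rewrite mulrACA -expRD addNr expR0 mul1r.
  rewrite (_ : _ * _ = 2 / n%:R); last by field; rewrite gt_eqF.
  by rewrite ler_pdivrMr// mul1r ler_nat.
have mEQ' : measurable_fun setT (fun w => (Q w)%:E) by exact/measurable_EFinP.
have EQ0 w : setT w -> (0 <= (Q w)%:E)%E by rewrite lee_fin.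
have Pcst c : (\int[P]_(w in setT) c%:E)%E = c%:E :> \bar R.
  by rewrite integral_cst//= probability_setT mule1.
have -> : (\int[P]_w (2 * (L * (b / n%:R)) +
    (s * n%:R)^-1 * (a + expR (- a) * Q w))%:E
   = (2 * (L * (b / n%:R)) + (s * n%:R)^-1 * a)%:E +
     ((s * n%:R)^-1 * expR (- a))%:E * \int[P]_w (Q w)%:E)%E.
  rewrite -ge0_integralZl//; last first.
    by rewrite lee_fin mulr_ge0 ?expR_ge0 ?(ltW sn0).
  rewrite -[X in (X + _)%E]Pcst -ge0_integralD//.
  - by apply: eq_integral => w _; rewrite -EFinM -EFinD; congr EFin; ring.
  - by move=> w _; rewrite lee_fin addr_ge0// mulr_ge0 ?(ltW sn0).
  - by move=> w _; rewrite -EFinM lee_fin !mulr_ge0 ?expR_ge0 ?(ltW sn0).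
  - by apply: emeasurable_funM.
apply: (@le_trans _ _ ((2 * (L * (b / n%:R)) + (s * n%:R)^-1 * a)%:E +
     ((s * n%:R)^-1 * expR (- a))%:E * (#|J|%:R * (2 * n%:R))%:E)%E).
  by rewrite leeD2l// lee_wpmul2l// lee_fin mulr_ge0 ?expR_ge0 ?(ltW sn0).
rewrite -EFinM -EFinD lee_fin.
rewrite [leLHS](_ : _ = 2 * (L * (b / n%:R)) + (s * n%:R)^-1 *
  (a + expR (- a) * (#|J|%:R * (2 * n%:R)))); last by ring.
have Mr : (s * n%:R)^-1 = 2 * M / (n%:R * r).
  by rewrite /s; field; rewrite !gt_eqF.
have h1 : 2 * (L * (b / n%:R)) <= 4 * (L * b) * r.
  have -> : 2 * (L * (b / n%:R)) = (2 * (L * b)) * n%:R^-1 by ring.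
  have -> : 4 * (L * b) * r = (2 * (L * b)) * (2 * r) by ring.
  by rewrite ler_wpM2l ?mulr_ge0// invn_le_rate.
have h2 : (s * n%:R)^-1 * (a + expR (- a) * (#|J|%:R * (2 * n%:R)))
    <= 2 * M * (D%:R + 4) * r.
  apply: (@le_trans _ _ ((s * n%:R)^-1 * ((D%:R + 4) * ln n%:R))).
    rewrite ler_pM2l// /a; move: QB; rewrite mulrDl [(D%:R + 4) * _]mulrDl; lra.
  rewrite Mr -nr le_eqVlt; apply/orP; left; apply/eqP.
  by field; rewrite !gt_eqF.
by rewrite [leRHS]mulrDl [leRHS]addrC; exact: lerD.
Qed.

End uniform_deviation.

(** * Deviation uniform over the network class *)

(* The integral of a nonnegative function is a supremum over the simple
   functions below it, hence monotone even at the gap of [u_n], which need not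
   be measurable in [w]. *)
Lemma expectation_le_dominated (R : realType) (disp : measure_display)
    (W : measurableType disp) (P : probability W R) (Z G : W -> R)
    (c : \bar R) :
  (forall w, 0 <= Z w) -> (forall w, Z w <= G w) ->
  (\int[P]_w (G w)%:E <= c)%E -> ('E_P[Z] <= c)%E.
Proof.
move=> Z0 ZG; apply: le_trans; rewrite unlock.
have G0 w : 0 <= G w by apply: le_trans (Z0 w) (ZG w).
rewrite !ge0_integralTE; [|by move=> w; rewrite lee_fin..].
apply: le_ereal_sup => _ [k /= kZ <-]; exists k => //= w.
by apply: le_trans (kZ w) _; rewrite lee_fin.
Qed.

Section network_deviation.
Context (R : realType) (disp : measure_display) (W : measurableType disp)
  (P : probability W R) (d : nat) (X : nat -> W -> 'cV[R]_d).
Variables (hidden : seq nat) (B : R).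
Hypotheses (hX : iid_uniform P X) (B0 : 0 < B).

Let T := (nn_param R d hidden * 'cV[R]_d)%type.
Let dom : set T := [set p | nn_bounded B p.1 /\ cube p.2].
(** Only the parameters move. With the points equal, data that are merely bounded in [x] have
    Lipschitz constant 0. *)
Let close (e : R) (p q : T) := nn_close e p.1 q.1 /\ p.2 = q.2.

Definition uniformly_regular (F : T -> R) : Prop :=
  bounded_lipschitz dom close F /\
  forall theta, measurable_fun cube (fun x => F (theta, x)).

Lemma sigmoid_closed_uniformly_regular : sigmoid_closed uniformly_regular.
Proof.
have cbl := sigmoid_closed_bounded_lipschitz dom close.
have cm := sigmoid_closed_measurable R (@cube R d).
split=> [c|f g [f1 f2] [g1 g2]|f g [f1 f2] [g1 g2]|f [f1 f2]].
- by split=> [|theta]; [exact: (closed_cst cbl)|exact: (closed_cst cm c)].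
- split=> [|theta]; first exact: (closedD cbl).
  exact: (closedD cm (f2 theta) (g2 theta)).
- split=> [|theta]; first exact: (closedM cbl).
  exact: (closedM cm (f2 theta) (g2 theta)).
split=> [|theta]; first exact: (closed_sigmoid cbl).
exact: (closed_sigmoid cm (f2 theta)).
Qed.

Lemma uniformly_regular_snd (f : 'cV[R]_d -> R) :
  measurable_fun cube f -> bounded_on cube f ->
  uniformly_regular (fun p => f p.2).
Proof.
move=> mf [M fM]; split=> [|theta //].
exists `|M|, 0; split=> // [p [_ /fM]|e p q _ _ _ [_ ->]].
  by move=> /le_trans; apply; exact: ler_norm.
by rewrite subrr normr0 mul0r.
Qed.

Let entries_bl : nn_entries (bounded_lipschitz dom close) fst.
Proof.
by apply: (nn_entries_bounded_lipschitz (ltW B0)) => [p []|e p q []].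
Qed.

Let coord_bl (i : 'I_d) : bounded_lipschitz dom close (fun p => p.2 i ord0).
Proof.
exists 1, 0; split=> // [p [_ /(_ i)/andP[x0 x1]]|e p q _ _ _ [_ ->]].
  by rewrite ger0_norm.
by rewrite subrr normr0 mul0r.
Qed.

Let coord_measurable (i : 'I_d) :
  measurable_fun cube (fun x : 'cV[R]_d => x i ord0).
Proof.
apply: (@measurable_funTS _ _ 'cV[R]_d R cube (vec_coord i)).
exact: measurable_vec_coord.
Qed.

Lemma uniformly_regular_nn_eval :
  uniformly_regular (fun p => nn_eval p.1 p.2).
Proof.
split=> [|theta].
  apply: (closed_nn (v := snd) (sigmoid_closed_bounded_lipschitz _ _) _ _ _).1;
    [exact: entries_bl|exact: coord_bl|exact: coord_bl].
have cm := sigmoid_closed_measurable R (@cube R d).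
apply: (closed_nn (v := id) (x := id) (theta := fun=> theta) cm _ _ _).1;
  [|exact: coord_measurable|exact: coord_measurable].
by apply: nn_entries_cst => c; exact: measurable_cst.
Qed.

Lemma uniformly_regular_energy :
  uniformly_regular (fun p => l2norm (grad (nn_eval p.1) p.2) ^+ 2).
Proof.
split=> [|theta].
  apply: (closed_energy (sigmoid_closed_bounded_lipschitz _ _));
    [exact: entries_bl|exact: coord_bl].
have cm := sigmoid_closed_measurable R (@cube R d).
apply: (closed_energy (x := id) (theta := fun=> theta) cm);
  [|exact: coord_measurable].
by apply: nn_entries_cst => c; exact: measurable_cst.
Qed.

Lemma network_deviation (F : T -> R) : uniformly_regular F ->
  exists2 lambda : R, 0 < lambda &
  forall n, (2 <= n)%N -> exists G : W -> R,
  [/\ measurable_fun setT G, forall w, 0 <= G w,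
    forall theta w, nn_bounded B theta ->
      `|deviation X (fun theta x => F (theta, x)) n theta w| <= G w &
    (\int[P]_w (G w)%:E <= (lambda * rate R n)%:E)%E].
Proof.
move=> [[K [L [K0 L0 FK FL]]] mF].
have [D net] := nn_net d hidden B0.
apply: (@uniform_deviation _ _ _ P _ _ hX _ [set theta | nn_bounded B theta]
  (fun e => @nn_close R e d hidden) D (2 * B) _ net _ K L) => //.
- by rewrite mulr_ge0// ltW.
- by move=> theta x St cx; apply: FK.
- by move=> e theta theta' x e0 St St' tt' cx; apply: FL.
Qed.

End network_deviation.

(** * The two losses and their minimizers *)

Section generalization.
Context (R : realType) (disp : measure_display) (W : measurableType disp)
  (P : probability W R) (d : nat) (X : nat -> W -> 'cV[R]_d).
Variables (hidden : seq nat) (B : R).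
Hypotheses (hX : iid_uniform P X) (B0 : 0 < B).

(** The interface between the losses and the minimizers: for each [n] a single [G] serves all
    [theta], hence also a [theta] chosen after the sample is seen. *)
Definition uniform_rate
    (gap : forall n : nat, nn_param R d hidden -> W -> R) : Prop :=
  exists2 lambda : R, 0 < lambda &
  forall n, (2 <= n)%N -> exists G : W -> R,
    (forall theta w, nn_bounded B theta -> `|gap n theta w| <= G w) /\
    (\int[P]_w (G w)%:E <= (lambda * rate R n)%:E)%E.

Lemma uniform_rate_poisson (f : 'cV[R]_d -> R) :
  measurable_fun cube f -> bounded_on cube f ->
  uniform_rate (fun n theta w => loss_poisson f (nn_eval theta) -
    emp_loss_poisson f (sample X n w) (nn_eval theta)).
Proof.
move=> mf bf.
have C := sigmoid_closed_uniformly_regular d hidden B.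
have ru := uniformly_regular_nn_eval d hidden B0.
have rf := uniformly_regular_snd hidden B mf bf.
have rF := closedB C
  (closedM C (closed_cst C 2^-1) (uniformly_regular_energy d hidden B0))
  (closedM C rf ru).
have [l1 l10 dev1] := network_deviation hX B0 rF.
have [l2 l20 dev2] := network_deviation hX B0 ru.
have [[K [_ [K0 _ uK _]]] mu_] := ru.
(* The squared averages differ by [(m + s) * (m - s)], where [m] is the integral and [s] the sample
   average of the network. The first factor is at most [2 * K] and the second is a deviation of the
   network itself; the factor [1/2] of the loss leaves [K * l2]. *)
exists (l1 + K * l2) => [|n n2]; first by rewrite ltr_wpDr ?mulr_ge0// ltW.
have [G1 [mG1 G10 devG1 iG1]] := dev1 n n2.
have [G2 [mG2 G20 devG2 iG2]] := dev2 n n2.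
exists (fun w => G1 w + K * G2 w); split; last first.
  under eq_integral do rewrite EFinD EFinM.
  rewrite ge0_integralD//; first last.
  - by apply: emeasurable_funM => //; exact/measurable_EFinP.
  - by move=> w _; rewrite -EFinM lee_fin mulr_ge0.
  - exact/measurable_EFinP.
  - by move=> w _; rewrite lee_fin.
  rewrite ge0_integralZl//; first last.
  - by move=> w _; rewrite lee_fin.
  - exact/measurable_EFinP.
  by rewrite mulrDl EFinD leeD// -mulrA EFinM lee_wpmul2l// lee_fin.
move=> theta w Btheta; case: hX => _ cX _ _.
have {}devG1 := devG1 theta w Btheta; have {}devG2 := devG2 theta w Btheta.
have n0 : 0 < (n%:R : R) by rewrite ltr0n (leq_trans _ n2).
set m := \int[lebesgue_rd R d]_(x in cube) nn_eval theta x.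
set s := n%:R^-1 * \sum_(j < n) nn_eval theta (X j w).
have mK : `|m| <= K.
  apply: norm_Rintegral_cube_le => [|x cx]; first exact: mu_.
  exact: (uK (theta, x)).
have sK : `|s| <= K.
  rewrite normrM ger0_norm ?invr_ge0 ?(ltW n0)// ler_pdivrMl//.
  apply: le_trans (ler_norm_sum _ _ _) _.
  rewrite mulr_natl -[n in leRHS]card_ord -sumr_const.
  by apply: ler_sum => j _; apply: (uK (theta, X j w)); split=> //; exact: cX.
rewrite (_ : _ - _ = deviation X (fun theta x =>
    2^-1 * l2norm (grad (nn_eval theta) x) ^+ 2 - f x * nn_eval theta x)
      n theta w + 2^-1 * (m + s) * (m - s)); last first.
  rewrite /loss_poisson /emp_loss_poisson /deviation -/m.
  under eq_bigr do rewrite tnth_mktuple.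
  under [in X in (_ * X) ^+ 2]eq_bigr do rewrite tnth_mktuple.
  rewrite -/s; ring.
apply: le_trans (ler_normD _ _) _; apply: lerD => //.
rewrite normrM ler_pM//.
rewrite normrM ger0_norm// ler_pdivrMl//.
by apply: le_trans (ler_normD _ _) _; lra.
Qed.

Lemma uniform_rate_schrodinger (g V : 'cV[R]_d -> R) :
  measurable_fun cube g -> bounded_on cube g ->
  measurable_fun cube V -> bounded_on cube V ->
  uniform_rate (fun n theta w => loss_schrodinger g V (nn_eval theta) -
    emp_loss_schrodinger g V (sample X n w) (nn_eval theta)).
Proof.
move=> mg bg mV bV.
have C := sigmoid_closed_uniformly_regular d hidden B.
have ru := uniformly_regular_nn_eval d hidden B0.
have rg := uniformly_regular_snd hidden B mg bg.
have rV := uniformly_regular_snd hidden B mV bV.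
have rF := closedB C (closedD C
    (closedM C (closed_cst C 2^-1) (uniformly_regular_energy d hidden B0))
    (closedM C (closedM C (closed_cst C 2^-1) rV) (closedX2 C ru)))
  (closedM C rg ru).
have [l l0 dev] := network_deviation hX B0 rF.
exists l => // n n2; have [G [_ _ devG iG]] := dev n n2.
exists G; split=> // theta w Btheta; have {}devG := devG theta w Btheta.
rewrite (_ : _ - _ = deviation X (fun theta x =>
    2^-1 * l2norm (grad (nn_eval theta) x) ^+ 2 +
    2^-1 * V x * nn_eval theta x ^+ 2 - g x * nn_eval theta x) n theta w)//.
rewrite /loss_schrodinger /emp_loss_schrodinger /deviation; congr (_ - _ * _).
  congr (fine (integral _ _ _)); apply/funext => x.
  by rewrite real_normK ?num_real.
by apply: eq_bigr => j _; rewrite tnth_mktuple real_normK ?num_real// addrAC.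
Qed.

Lemma expected_gap_argmin
    (loss : ('cV[R]_d -> R) -> R)
    (emp_loss : forall n, n.-tuple 'cV[R]_d -> ('cV[R]_d -> R) -> R) :
  uniform_rate (fun n theta w => loss (nn_eval theta) -
    emp_loss n (sample X n w) (nn_eval theta)) ->
  exists2 lambda : R, 0 < lambda &
    forall n : nat, (2 <= n)%N ->
    forall (u_n : n.-tuple 'cV[R]_d -> 'cV[R]_d -> R) (u_F : 'cV[R]_d -> R),
      measurable_argmin (nn_class hidden B) (emp_loss n) u_n ->
      argmin (nn_class hidden B) loss u_F ->
      ('E_P[fun w => `|loss (u_n (sample X n w))
           - emp_loss n (sample X n w) (u_n (sample X n w))|%R]
        <= (lambda * n%:R `^ (- 2^-1) * ln n%:R `^ 2^-1)%:E)%E /\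
      ('E_P[fun w => `|loss u_F - emp_loss n (sample X n w) u_F|%R]
        <= (lambda * n%:R `^ (- 2^-1) * ln n%:R `^ 2^-1)%:E)%E.
Proof.
move=> [l l0 rate_l]; exists l => // n n2 u_n u_F.
move=> [argmin_n _] [[theta_F BF <-] _].
have [G [gapG iG]] := rate_l n n2.
have dominated (v : W -> 'cV[R]_d -> R) : (forall w, nn_class hidden B (v w)) ->
    ('E_P[fun w => `|loss (v w) - emp_loss n (sample X n w) (v w)|%R]
      <= (l * n%:R `^ (- 2^-1) * ln n%:R `^ 2^-1)%:E)%E.
  move=> Fv; apply: expectation_le_dominated => // [w|].
    by have [theta Btheta <-] := Fv w; exact: gapG.
  by rewrite -mulrA.
split; last by apply: (dominated (fun=> nn_eval theta_F)) => w; exists theta_F.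
apply: (dominated (fun w => u_n (sample X n w))) => w.
(* The selection is constrained on samples from the cube, and the points [X j w] lie there for every
   outcome [w]. *)
apply: (argmin_n _ _).1 => j; rewrite tnth_mktuple.
by case: hX => _ cX _ _; exact: cX.
Qed.

End generalization.

Theorem theorem3p5 (R : realType) (d : nat) (hidden : seq nat) (BTheta : R)
    (hd : (1 <= d)%N) (hhidden : all (fun k => (1 <= k)%N) hidden)
    (hB : 0 < BTheta)
    (disp : measure_display) (W : measurableType disp) (P : probability W R)
    (X : nat -> W -> 'cV[R]_d) (hX : iid_uniform P X) :
  (forall f : 'cV[R]_d -> R,
    measurable_fun cube f ->
    (lebesgue_rd R d).-integrable cube (fun x => (f x ^+ 2)%:E) ->
    \int[lebesgue_rd R d]_(x in cube) f x = 0 ->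
    bounded_on cube f ->
    exists2 lambda1 : R, 0 < lambda1 &
      forall n : nat, (2 <= n)%N ->
      forall (u_n : n.-tuple 'cV[R]_d -> 'cV[R]_d -> R) (u_F : 'cV[R]_d -> R),
        measurable_argmin (nn_class hidden BTheta)
          (emp_loss_poisson f (n := n)) u_n ->
        argmin (nn_class hidden BTheta) (loss_poisson f) u_F ->
        ('E_P[fun w => `|loss_poisson f (u_n (sample X n w))
             - emp_loss_poisson f (sample X n w) (u_n (sample X n w))|%R]
          <= (lambda1 * n%:R `^ (- 2^-1) * ln n%:R `^ 2^-1)%:E)%E /\
        ('E_P[fun w => `|loss_poisson f u_F
             - emp_loss_poisson f (sample X n w) u_F|%R]
          <= (lambda1 * n%:R `^ (- 2^-1) * ln n%:R `^ 2^-1)%:E)%E)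
  /\
  (forall (g V : 'cV[R]_d -> R) (Vmin Vmax : R),
    measurable_fun cube g ->
    bounded_on cube g ->
    measurable_fun cube V ->
    0 < Vmin ->
    (forall x, cube x -> Vmin <= V x <= Vmax) ->
    exists2 lambda2 : R, 0 < lambda2 &
      forall n : nat, (2 <= n)%N ->
      forall (u_n : n.-tuple 'cV[R]_d -> 'cV[R]_d -> R) (u_F : 'cV[R]_d -> R),
        measurable_argmin (nn_class hidden BTheta)
          (emp_loss_schrodinger g V (n := n)) u_n ->
        argmin (nn_class hidden BTheta) (loss_schrodinger g V) u_F ->
        ('E_P[fun w => `|loss_schrodinger g V (u_n (sample X n w))
             - emp_loss_schrodinger g V (sample X n w) (u_n (sample X n w))|%R]
          <= (lambda2 * n%:R `^ (- 2^-1) * ln n%:R `^ 2^-1)%:E)%E /\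
        ('E_P[fun w => `|loss_schrodinger g V u_F
             - emp_loss_schrodinger g V (sample X n w) u_F|%R]
          <= (lambda2 * n%:R `^ (- 2^-1) * ln n%:R `^ 2^-1)%:E)%E).
Proof.
split=> [f mf _ _ bf|g V Vmin Vmax mg bg mV Vmin0 bV].
  exact/(expected_gap_argmin hX)/uniform_rate_poisson.
apply/(expected_gap_argmin hX)/uniform_rate_schrodinger => //.
exists Vmax => x cx; have /andP[Vx1 Vx2] := bV x cx.
by rewrite ger0_norm// (le_trans (ltW Vmin0)).
Qed.
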